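(* Let $k,\lambda,\beta_1,\beta_2>0$ and $p\in[0,1]$. Let $X(t)$ be the solution of $dX(t)=-kX(t)\,dt+dZ(t)$, $X(0)=x_0$, where $Z$ is a compound Poisson process with intensity $\lambda$ whose jumps are distributed according to the double exponential law with density $$f_{\beta_1,\beta_2,p}(x)=p\,\beta_1e^{-\beta_1x}\mathbf{1}_{x\ge0}+(1-p)\,\beta_2e^{\beta_2x}\mathbf{1}_{x<0}$$ and characteristic function $\varphi_{\beta_1,\beta_2,p}(v)=p\frac{\beta_1}{\beta_1-iv}+(1-p)\frac{\beta_2}{\beta_2+iv}$. Then, for $s\ge 0$, $t>0$ and $v\in\mathbb{R}$, the characteristic function of $X(t+s)$ conditional on $X(s)$ is $$\mathbf{E}\left[e^{ivX(t+s)}\,\middle|\,X(s)\right]=e^{ivX(s)e^{-kt}}\left(\frac{\beta_1-ive^{-kt}}{\beta_1-iv}\right)^{\frac{p\lambda}{k}}\left(\frac{\beta_2+ive^{-kt}}{\beta_2+iv}\right)^{\frac{(1-p)\lambda}{k}}.$$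
   Context: A compound Poisson process with intensity $\lambda$ is $Z(t)=\sum_{n=1}^{N(t)}J_n$ with $N$ a Poisson process of intensity $\lambda$ and $J_n$ i.i.d. jumps independent of $N$; the solution of the equation is $X(t)=x_0e^{-kt}+\sum_{n=1}^{N(t)}e^{-k(t-\tau_n)}J_n$ with $\tau_n$ the jump times of $N$. Complex powers are taken with the principal branch of each gamma characteristic function factor, i.e. $(\beta\mp iz)^{c}$ is defined via the principal logarithm (the real part of the base being positive), and the power of a quotient is the quotient of the powers. *)

(* Defs.v *)
From HB Require Import structures.
From mathcomp Require Export all_boot all_order all_algebra.
From mathcomp Require Export all_classical all_reals all_analysis.
From mathcomp.real_closed Require Export complex.

Set Implicit Arguments.
Unset Strict Implicit.
Unset Printing Implicit Defensive.

Import Order.TTheory GRing.Theory Num.Theory.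
Import numFieldNormedType.Exports.

Local Open Scope classical_set_scope.
Local Open Scope ring_scope.
Local Open Scope complex_scope.

Section ComplexPower.
Context {R : realType}.
Implicit Types (z : R[i]) (c : R).

Definition cmod z : R := Num.sqrt (complex.Re z ^+ 2 + complex.Im z ^+ 2).

(* Principal argument, in ]-pi, pi]. *)
Definition carg z : R :=
  let theta := acos (complex.Re z / cmod z) in
  if 0 <= complex.Im z then theta else - theta.

Definition clog z : R[i] := ln (cmod z) +i* carg z.

Definition cexp z : R[i] :=
  (expR (complex.Re z))%:C * (cos (complex.Im z) +i* sin (complex.Im z)).

(* Principal power, meant for z != 0. *)
Definition cpow z c : R[i] := cexp (c%:C * clog z).

End ComplexPower.

Section Probability.
Context {R : realType} {d : measure_display} {T : measurableType d}.
Variable P : probability T R.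

Definition sigma_family {I : Type} {d' : measure_display}
    {S : measurableType d'} (D : set I) (Y : I -> T -> S) : set (set T) :=
  <<s \bigcup_(i in D) g_sigma_algebra_preimage (Y i) >>.

Definition independent2 (G H : set (set T)) : Prop :=
  forall A B, G A -> H B -> P (A `&` B) = (P A * P B)%E.

Definition mutually_independent (I : eqType) (G : I -> set (set T)) : Prop :=
  forall (s : seq I) (A : I -> set T), uniq s ->
    (forall i, i \in s -> G i (A i)) ->
    P (\big[setI/setT]_(i <- s) A i) = (\prod_(i <- s) P (A i))%E.

Definition has_density (Y : T -> R) (f : R -> R) : Prop :=
  forall A : set R, measurable A ->
    P (Y @^-1` A) = (\int[lebesgue_measure]_(x in A) (f x)%:E)%E.

(* g is a version of the conditional expectation of Y given G. *)
Definition is_cond_expectation (G : set (set T)) (Y g : T -> R) : Prop :=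
  [/\ P.-integrable setT (EFin \o Y),
      forall B : set R, measurable B -> G (g @^-1` B),
      P.-integrable setT (EFin \o g) &
      forall A, G A ->
        (\int[P]_(w in A) (Y w)%:E = \int[P]_(w in A) (g w)%:E)%E].

Definition is_cond_expectationC (G : set (set T)) (Y g : T -> R[i]) : Prop :=
  is_cond_expectation G (fun w => complex.Re (Y w)) (fun w => complex.Re (g w))
  /\
  is_cond_expectation G (fun w => complex.Im (Y w)) (fun w => complex.Im (g w)).

(* In all the processes below, only the times t >= 0 matter. *)

Definition poisson_process (lambda : R) (N : R -> {RV P >-> nat}) : Prop :=
  [/\ {ae P, forall w,
        [/\ N 0 w = 0%N,
            forall s t, 0 <= s -> s <= t -> (N s w <= N t w)%N &
            forall t, 0 <= t -> \forall u \near t^'+, N u w = N t w]},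
      forall s t, 0 <= s -> s < t -> forall n : nat,
        P [set w | N t w = (N s w + n)%N]
        = (poisson_pmf (lambda * (t - s)) n)%:E &
      forall (n : nat) (t : nat -> R), 0 <= t 0%N ->
        (forall i, t i <= t i.+1) ->
        mutually_independent (fun i : 'I_n => g_sigma_algebra_preimage
          (fun w => (N (t i.+1) w)%:R - (N (t i) w)%:R : R))].

(* J n is the (n+1)-st jump. *)
Definition compound_poisson_process (lambda : R) (f : R -> R)
    (Z : R -> T -> R) : Prop :=
  exists (N : R -> {RV P >-> nat}) (J : nat -> {RV P >-> R}),
    [/\ poisson_process lambda N,
        mutually_independent (fun n => g_sigma_algebra_preimage (J n)),
        forall n, has_density (J n) f,
        independent2 (sigma_family [set t : R | 0 <= t] (fun t => N t : T -> nat))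
                     (sigma_family [set: nat] (fun n => J n : T -> R)) &
        forall t w, 0 <= t -> Z t w = \sum_(n < N t w) J n w].

(* dX(t) = - k X(t) dt + dZ(t), X(0) = x0, in integral form along almost
   every path. *)
Definition sde_solution (k x0 : R) (Z X : R -> T -> R) : Prop :=
  {ae P, forall w, X 0 w = x0 /\
    forall t, 0 <= t ->
      lebesgue_measure.-integrable `[0, t] (EFin \o X ^~ w) /\
      X t w - X 0 w = - k * (\int[lebesgue_measure]_(u in `[0, t]) X u w)
                      + (Z t w - Z 0 w)}.

End Probability.

Definition double_exponential_pdf {R : realType} (beta1 beta2 p x : R) : R :=
  p * beta1 * expR (- beta1 * x) * (0 <= x)%R%:R
  + (1 - p) * beta2 * expR (beta2 * x) * (x < 0)%R%:R.

(* Main.v *)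
(* The equation is discretised by the Euler scheme with n steps, so that no
   stochastic integral and no law of the jump times is needed. With h = t / n
   and q = 1 - k h,
     X(s + t) = q^n X(s) + sum_j q^(n-1-j) (Z(s + (j+1) h) - Z(s + j h)) + O(1/n)
   on almost every path, because one step has error at most O(h) times the sum
   of h and the variation of Z over the step. Over one step Z jumps 0 times,
   once, or (with probability O(h^2)) more often, so, given the past,
   multiplying by exp(i theta (increment of Z)) multiplies an
   expectation by
     1 + lambda h (phi(theta) - 1) + O(h^2)
       = exp(Lambda(q theta) - Lambda(theta)) + O(h^2),
   where exp(Lambda(v e^(-kt)) - Lambda(v)) is the claimed factor: the function
   Lambda satisfies - k theta Lambda'(theta) = lambda (phi(theta) - 1). As theta
   runs through v q^j these factors telescope, with total error O(1/n). This
   gives E[f(X(s)) e^(ivX(s+t))] for continuous bounded f (X(s) being itself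
   replaced by its Euler approximation, which is a function of finitely many
   increments), and a pi-lambda argument passes to indicators of Borel sets. *)
From HB Require Import structures.
Require Import Defs.
From mathcomp Require Import ring lra measurable_realfun.

Set Implicit Arguments.
Unset Strict Implicit.
Unset Printing Implicit Defensive.

Import Order.TTheory GRing.Theory Num.Theory.
Import numFieldNormedType.Exports.
Import Normc.

Local Open Scope classical_set_scope.
Local Open Scope ring_scope.
Local Open Scope complex_scope.

(** * Bounded random variables and independence *)

(** The obstacle is the random index of the jumps: over a step from [t m] the process [Z] adds
    [J (N (t m))], and no fixed [J n] is the next jump. On the event [N (t m) = q], however, the
    history is a function of the first [m] increments of [N] and of the first [q] jumps, all
    independent of the next increment and of [J q]. As the law of [J q] does not depend on [q],
    summing over [q] gives a product rule for the past and the next step. Since [N] starts at 0 and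
    is monotone only almost surely, these descriptions of the history hold on good paths, while the
    variables that enter independence are exact functions of the increments.

    One-step errors add up instead of being amplified because each factor exp(Lambda(q theta) -
    Lambda(theta)) has modulus at most 1 when [0 <= q <= 1]. Test functions are continuous because
    the approximation of [X s] converges only pointwise almost surely, and expectations are taken of
    bounded variables only, so that dominated convergence and Fubini apply throughout. *)

Section BoundedRandomVariables.
Context {R : realType} {d : measure_display} {T : measurableType d}.
Variable P : probability T R.
Implicit Types f g X Y : T -> R.

(* [brv] stands for bounded random variable. *)
Definition brv f := measurable_fun setT f /\ exists M : R, forall w, `|f w| <= M.

Definition Ex f : R := \int[P]_w f w.

Lemma brv_integrable f : brv f -> P.-integrable setT (EFin \o f).
Proof.
move=> [mf [M hM]]; apply: measurable_bounded_integrable => //.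
  by rewrite (le_lt_trans (probability_le1 _ _))// ltry.
exists M; split; first exact: num_real.
by move=> x Mx w _ /=; rewrite (le_trans (hM w))// ltW.
Qed.

Lemma brv_cst c : brv (fun=> c).
Proof. by split; [exact: measurable_cst|exists `|c|]. Qed.

Lemma brvD f g : brv f -> brv g -> brv (fun w => f w + g w).
Proof.
move=> [mf [M hM]] [mg [K hK]]; split; first exact: measurable_funD.
by exists (M + K) => w; rewrite (le_trans (ler_normD _ _))// lerD.
Qed.

Lemma brvM f g : brv f -> brv g -> brv (fun w => f w * g w).
Proof.
move=> [mf [M hM]] [mg [K hK]]; split; first exact: measurable_funM.
by exists (M * K) => w; rewrite normrM ler_pM.
Qed.

Lemma brvZ c f : brv f -> brv (fun w => c * f w).
Proof. by move=> bf; apply: brvM => //; exact: brv_cst. Qed.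

Lemma brvN f : brv f -> brv (fun w => - f w).
Proof. by move=> /(brvZ (-1)); under eq_fun do rewrite mulN1r. Qed.

Lemma brvB f g : brv f -> brv g -> brv (fun w => f w - g w).
Proof. by move=> bf bg; apply: brvD => //; exact: brvN. Qed.

Lemma brv_sum (I : Type) (r : seq I) (F : I -> T -> R) :
  (forall i, brv (F i)) -> brv (fun w => \sum_(i <- r) F i w).
Proof.
move=> bF; elim: r => [|i r ih].
  by under eq_fun do rewrite big_nil; exact: brv_cst.
by under eq_fun do rewrite big_cons; exact: brvD.
Qed.

Lemma brv_indic (A : set T) : measurable A -> brv (\1_A : T -> R).
Proof.
move=> mA; split; first exact: measurable_indic.
by exists 1 => w; rewrite indicE; case: (_ \in _); rewrite ?normr1 ?normr0.
Qed.

Lemma brv_comp (f : R -> R) X : measurable_fun setT X -> measurable_fun setT f ->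
  (exists M : R, forall x, `|f x| <= M) -> brv (f \o X).
Proof.
move=> mX mf [M hM]; split; first exact: measurableT_comp.
by exists M => w; exact: hM.
Qed.

Lemma ExD f g : brv f -> brv g -> Ex (fun w => f w + g w) = Ex f + Ex g.
Proof. by move=> bf bg; rewrite /Ex RintegralD//; exact: brv_integrable. Qed.

Lemma ExB f g : brv f -> brv g -> Ex (fun w => f w - g w) = Ex f - Ex g.
Proof. by move=> bf bg; rewrite /Ex RintegralB//; exact: brv_integrable. Qed.

Lemma ExZ c f : brv f -> Ex (fun w => c * f w) = c * Ex f.
Proof. by move=> bf; rewrite /Ex RintegralZl//; exact: brv_integrable. Qed.

Lemma ExZr c f : brv f -> Ex (fun w => f w * c) = Ex f * c.
Proof. by move=> bf; rewrite /Ex RintegralZr//; exact: brv_integrable. Qed.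

Lemma Ex_cst c : Ex (fun=> c) = c.
Proof.
rewrite /Ex Rintegral_cst// -[RHS]mulr1; congr (_ * _).
exact: (congr1 fine (probability_setT P)).
Qed.

Lemma Ex_sum (I : Type) (r : seq I) (F : I -> T -> R) :
  (forall i, brv (F i)) ->
  Ex (fun w => \sum_(i <- r) F i w) = \sum_(i <- r) Ex (F i).
Proof.
move=> bF; elim: r => [|i r ih].
  by under eq_fun do rewrite big_nil; rewrite Ex_cst big_nil.
under eq_fun do rewrite big_cons.
by rewrite big_cons -ih ExD//; exact: brv_sum.
Qed.

Lemma Ex_indic (A : set T) : measurable A -> Ex \1_A = fine (P A).
Proof. by move=> mA; rewrite /Ex /Rintegral integral_indic// setIT. Qed.

Lemma le_Ex f g : brv f -> brv g -> (forall w, f w <= g w) -> Ex f <= Ex g.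
Proof. by move=> bf bg fg; apply: le_Rintegral => //; exact: brv_integrable. Qed.

Lemma le_norm_Ex f g : brv f -> brv g -> (forall w, `|f w| <= g w) ->
  `|Ex f| <= Ex g.
Proof.
move=> bf bg fg; rewrite ler_norml -mulN1r -ExZ//.
by apply/andP; split; apply: le_Ex => //; [exact: brvZ| |] => w;
  have := fg w; rewrite ler_norml ?mulN1r => /andP[].
Qed.

Lemma Ex_ae f g : measurable_fun setT f -> measurable_fun setT g ->
  {ae P, forall w, f w = g w} -> Ex f = Ex g.
Proof.
move=> mf mg fg; congr fine; apply: ae_eq_integral => //.
- exact/measurable_EFinP.
- exact/measurable_EFinP.
- by apply: filterS fg => w /= ->.
Qed.

Lemma Ex_cvg (F : nat -> T -> R) f (M : R) :
  (forall n, measurable_fun setT (F n)) ->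
  measurable_fun setT f -> (forall n w, `|F n w| <= M) ->
  {ae P, forall w, F n w @[n --> \oo] --> f w} ->
  Ex (F n) @[n --> \oo] --> Ex f.
Proof.
move=> mF mf hM Ff.
have [i0 _ h] : [/\ P.-integrable setT (EFin \o f),
    [sequence (\int[P]_(x in setT) `|(EFin \o F n) x - (EFin \o f) x|)%E]_n
      @ \oo --> 0%E &
    [sequence (\int[P]_(x in setT) ((EFin \o F n) x))%E]_n
      @ \oo --> (\int[P]_(x in setT) ((EFin \o f) x))%E].
  apply: (@dominated_convergence _ _ _ _ _ _ _ _ (EFin \o cst M)) => //.
  - by move=> n; exact/measurable_EFinP.
  - exact/measurable_EFinP.
  - by apply: filterS Ff => w h _; apply: cvg_EFin => //; exact: nearW.
  - exact/brv_integrable/brv_cst.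
  - by apply: aeW => w n _ /=; rewrite lee_fin.
apply: fine_cvg; rewrite fineK//; exact: integrable_fin_num.
Qed.

(** The events on which a bounded [Y] integrates to zero form a lambda-system: [Ex Y = 0] puts the
    whole space in it, and dominated convergence handles increasing unions. It serves twice, for
    independence and for the passage to Borel sets. *)
Lemma pi_lambda_Ex (G : set (set T)) Y : brv Y -> Ex Y = 0 ->
  setI_closed G -> G `<=` measurable ->
  (forall A, G A -> Ex (fun w => \1_A w * Y w) = 0) ->
  forall A, <<s G >> A -> Ex (fun w => \1_A w * Y w) = 0.
Proof.
move=> bY Y0 GI Gm GY.
pose H := [set A : set T | measurable A /\ Ex (fun w => \1_A w * Y w) = 0].
suff HH : lambda_system setT H.
  move=> A sA; suff [] : H A by [].
  apply: (lambda_system_subset GI HH) sA => //.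
  by move=> B GB; split; [exact: Gm|exact: GY].
split => //.
- split => //; rewrite -[RHS]Y0; congr Ex; apply/funext => w.
  by rewrite indicE in_setT mul1r.
- move=> A B BA [mA A0] [mB B0]; split; first exact: measurableD.
  transitivity (Ex (fun w => \1_A w * Y w - \1_B w * Y w)).
    congr Ex; apply/funext => w; rewrite -mulrBl; congr (_ * _).
    rewrite !indicE in_setD; case: (boolP (w \in B)) => wB /=.
      by rewrite (mem_set (BA _ (set_mem wB))) subrr.
    by rewrite andbT subr0.
  by rewrite ExB ?A0 ?B0 ?subrr//; apply: brvM => //; exact: brv_indic.
- move=> F ndF HF; have mF i : measurable (F i) by case: (HF i).
  have mU : measurable (\bigcup_i F i) by exact: bigcupT_measurable.
  split => //.
  have [mY [M hM]] := bY.
  have h : Ex (fun w => \1_(F n) w * Y w) @[n --> \oo] -->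
      Ex (fun w => \1_(\bigcup_i F i) w * Y w).
    apply: (@Ex_cvg _ _ M).
    + by move=> n; apply: measurable_funM => //; exact: measurable_indic.
    + by apply: measurable_funM => //; exact: measurable_indic.
    + move=> n w; rewrite normrM (le_trans _ (hM w))// ler_piMl//.
      by rewrite indicE; case: (_ \in _); rewrite ?normr1 ?normr0.
    + apply: aeW => w; apply: cvgM; last exact: cvg_cst.
      have [[N _ FNw]|nF] := pselect ((\bigcup_i F i) w).
        rewrite indicE (_ : (w \in _) = true); last by apply/mem_set; exists N.
        apply: cvg_near_cst; near=> n.
        rewrite indicE mem_set//.
        suff /subsetPset : (F N <= F n)%O by apply.
        by apply: ndF; near: n; exact: nbhs_infty_ge.
      apply: cvg_near_cst; near=> n.
      have nFn : ~ F n w by move=> h; apply: nF; exists n.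
      by rewrite !indicE !memNset.
  have : Ex (fun w => \1_(F n) w * Y w) @[n --> \oo] --> (0 : R).
    by apply: cvg_near_cst; apply: nearW => n; case: (HF n).
  by move=> h0; apply: (cvg_unique _ h h0).
Unshelve. all: by end_near.
Qed.

(** The hypothesis makes the law of the pair agree with the product of the two laws on rectangles,
    hence everywhere; Fubini then factors the integral. *)
Lemma Ex_indep X Y : brv X -> brv Y ->
  (forall A B, measurable A -> measurable B ->
    P (X @^-1` A `&` Y @^-1` B) = (P (X @^-1` A) * P (Y @^-1` B))%E) ->
  Ex (fun w => X w * Y w) = Ex X * Ex Y.
Proof.
move=> bX bY XY.
have bXY := brvM bX bY.
have [[mX _] [mY _]] := (bX, bY).
pose Xm : {mfun T >-> R} := HB.pack X (isMeasurableFun.Build _ _ _ _ X mX).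
pose Ym : {mfun T >-> R} := HB.pack Y (isMeasurableFun.Build _ _ _ _ Y mY).
pose W w := (X w, Y w).
have mW : measurable_fun setT W by exact: measurable_fun_pair.
pose Wm : {mfun T >-> (R * R)%type} := HB.pack W (isMeasurableFun.Build _ _ _ _ W mW).
pose f (z : R * R) := (z.1 * z.2)%:E.
have mf : measurable_fun setT f.
  by apply/measurable_EFinP; apply: measurable_funM.
have prodE A : measurable A ->
    (distribution P Xm \x distribution P Ym)%E A = distribution P Wm A.
  by move=> mA; apply: product_measure_unique => // B C mB mC; exact: XY.
have intW : (distribution P Wm).-integrable setT f.
  by apply: integrable_pushforward => //; exact: brv_integrable bXY.
have eW : (\int[P]_w (X w * Y w)%:E = \int[distribution P Wm]_z f z)%E.
  by rewrite integral_pushforward//; exact: brv_integrable bXY.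
have eP : (\int[distribution P Wm]_z f z =
    \int[distribution P Xm \x distribution P Ym]_z f z)%E.
  by apply: eq_measure_integral => A mA _; exact/esym/prodE.
have intP : (distribution P Xm \x distribution P Ym)%E.-integrable setT f.
  move/integrableP : intW => [_ h]; apply/integrableP; split => //.
  apply: le_lt_trans h; rewrite le_eqVlt; apply/orP; left; apply/eqP.
  by apply: eq_measure_integral => A mA _; exact: prodE.
have dX : (\int[distribution P Xm]_x x%:E = (Ex X)%:E)%E.
  rewrite integral_pushforward//; last exact: brv_integrable bX.
  by rewrite /Ex /Rintegral fineK//; exact: integrable_fin_num (brv_integrable bX).
have dY : (\int[distribution P Ym]_x x%:E = (Ex Y)%:E)%E.
  rewrite integral_pushforward//; last exact: brv_integrable bY.
  by rewrite /Ex /Rintegral fineK//; exact: integrable_fin_num (brv_integrable bY).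
rewrite {1}/Ex /Rintegral eW eP -integral12_prod_meas1// /fubini_F/= /f/=.
transitivity (fine (\int[distribution P Xm]_x ((Ex Y)%:E * x%:E)%E)).
  congr fine; apply: eq_integral => x _.
  under eq_integral do rewrite EFinM.
  rewrite integralZl//; first by rewrite dY muleC.
  by apply: integrable_pushforward => //; exact: brv_integrable bY.
rewrite integralZl//; first by rewrite dX mulrC.
by apply: integrable_pushforward => //; exact: brv_integrable bX.
Qed.

End BoundedRandomVariables.

Section IndependentFamily.
Context {R : realType} {d : measure_display} {T : measurableType d}.
Variable P : probability T R.
Context {I : eqType}.
Variable W : I -> T -> R.
Hypothesis mW : forall i, measurable_fun setT (W i).
Hypothesis indW :
  mutually_independent P (fun i => g_sigma_algebra_preimage (W i)).

Definition gens (s : seq I) : set (set T) :=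
  \bigcup_(i in [set` s]) g_sigma_algebra_preimage (W i).

Definition adapted (s : seq I) (H : T -> R) :=
  measurable_fun setT (H : g_sigma_algebraType (gens s) -> R).

(** Cylinder events. Unlike [gens s], they are stable under intersection, and mutual independence
    speaks about them directly. *)
Let rects (s : seq I) : set (set T) :=
  [set A | exists2 B : I -> set R, forall i, measurable (B i) &
    A = \big[setI/setT]_(i <- s) (W i @^-1` B i)].

Lemma measurable_preimage i (B : set R) : measurable B -> measurable (W i @^-1` B).
Proof. by move=> mB; rewrite -[X in measurable X]setTI; exact: mW. Qed.

Let rects_measurable s : rects s `<=` measurable.
Proof.
move=> _ [B mB ->]; elim/big_ind : _ => //; first exact: measurableI.
by move=> i _; exact: measurable_preimage.
Qed.

Let gens_rects s : uniq s -> gens s `<=` rects s.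
Proof.
move=> us _ [i /= si [B mB <-]].
exists (fun j => if j == i then B else setT); first by move=> j; case: ifP.
rewrite (bigD1_seq i)//= eqxx setTI big1 ?setIT// => j /negPf ->.
by rewrite preimage_setT.
Qed.

Lemma sigma_gens_measurable s : <<s gens s >> `<=` measurable.
Proof.
apply: smallest_sub; first exact: sigma_algebra_measurable.
by move=> _ [i _ [B mB <-]]; rewrite setTI; exact: measurable_preimage.
Qed.

Lemma adapted_measurable s H : adapted s H -> measurable_fun setT H.
Proof.
by move=> aH _ B mB; apply: sigma_gens_measurable; exact: (aH measurableT B mB).
Qed.

Lemma adapted_base s i : i \in s -> adapted s (W i).
Proof.
move=> si _ B mB; apply: sub_sigma_algebra.
by exists i => //; exists B.
Qed.

(** Mutual independence only gives the product rule for cylinder events over [s] against events of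
    [W j]; the pi-lambda argument extends it to the sigma-algebra of [s], and [Ex_indep] turns it
    into a rule for expectations. *)
Lemma Ex_adaptedM s j H (g : R -> R) : uniq (j :: s) ->
  adapted s H -> brv H -> measurable_fun setT g -> (exists M : R, forall x, `|g x| <= M) ->
  Ex P (fun w => H w * g (W j w)) = Ex P H * Ex P (g \o W j).
Proof.
move=> us aH bH mg bg.
have us' : uniq s by case/andP : us.
apply: (@Ex_indep _ _ _ P H (g \o W j)) => //; first exact: brv_comp.
move=> A B mA mB.
have {aH} sA : <<s rects s >> (H @^-1` A).
  apply: (@sub_sigma_algebra2 _ _ _ (gens s)); first exact: gens_rects.
  by have := aH measurableT A mA; rewrite setTI.
have {mg} : measurable (g @^-1` B) by rewrite -[X in measurable X]setTI; exact: mg.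
rewrite comp_preimage; move: (g @^-1` B) => {B mB bg}B mB.
set E := W j @^-1` B.
have mE : measurable E by exact: measurable_preimage.
have PE : P E = (fine (P E))%:E by rewrite fineK// fin_num_measure.
have mH : measurable (H @^-1` A).
  by rewrite -[X in measurable X]setTI; case: bH => mH _; exact: mH.
(* Integrating this centred indicator over [C] gives the defect of the product rule for [C] and [E],
   so independence becomes the vanishing of an expectation. *)
pose Y w : R := \1_E w - fine (P E).
have bY : brv Y by apply: brvB; [exact: brv_indic|exact: brv_cst].
have ExY C : measurable C ->
    Ex P (fun w => \1_C w * Y w) = fine (P (C `&` E)) - fine (P C) * fine (P E).
  move=> mC; transitivity (Ex P (fun w => \1_(C `&` E) w - \1_C w * fine (P E))).
    by congr Ex; apply/funext => w; rewrite indicI/= mulrBr.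
  rewrite ExB ?ExZr ?Ex_indic//; [exact: measurableI|exact: brv_indic| |].
    by apply: brv_indic; exact: measurableI.
  by apply: brvM; [exact: brv_indic|exact: brv_cst].
have /eqP : Ex P (fun w => \1_(H @^-1` A) w * Y w) = 0.
  apply: (pi_lambda_Ex bY _ _ (@rects_measurable s)) => //.
  - by rewrite ExB ?Ex_indic ?Ex_cst ?subrr//; [exact: brv_indic|exact: brv_cst].
  - move=> _ _ [B1 m1 ->] [B2 m2 ->]; exists (fun i => B1 i `&` B2 i).
      by move=> i; exact: measurableI.
    by rewrite -big_split/=; apply: eq_bigr => i _; rewrite preimage_setI.
  - move=> C rC; rewrite ExY; last exact: rects_measurable rC.
    case: rC => D mD ->.
    (* As [j] is not in [s], putting [B] at [j] leaves the cylinder unchanged and lets one family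
       describe both events. *)
    pose D' i := if i == j then B else D i.
    have D'D : \big[setI/setT]_(i <- s) (W i @^-1` D i) =
               \big[setI/setT]_(i <- s) (W i @^-1` D' i).
      apply: eq_big_seq => i si; rewrite /D'; case: eqP => // ij.
      by move: us; rewrite /= -ij si.
    have mD' i : measurable (D' i) by rewrite /D'; case: ifP.
    have pD' i : g_sigma_algebra_preimage (W i) (W i @^-1` D' i).
      by exists (D' i); rewrite ?setTI.
    have := @indW (j :: s) (fun i => W i @^-1` D' i) us (fun i _ => pD' i).
    rewrite !big_cons -(@indW s (fun i => W i @^-1` D' i) us' (fun i _ => pD' i)).
    rewrite -D'D /D' eqxx -/E setIC => ->.
    rewrite fineM ?fin_num_measure//; first by rewrite mulrC subrr.
    by apply: (@rects_measurable s); exists D.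
rewrite ExY// subr_eq0 => /eqP h.
rewrite -[LHS]fineK ?fin_num_measure//; last exact: measurableI.
by rewrite h EFinM !fineK ?fin_num_measure.
Qed.

End IndependentFamily.

(** * Elementary estimates *)

Section RealEstimates.
Context {R : realType}.
Implicit Types (x y a b beta theta : R).

Lemma mean_value (f f' : R -> R) x y :
  (forall z : R, is_derive z (1 : R) f (f' z)) ->
  exists2 c, `|c - x| <= `|y - x| & f y - f x = f' c * (y - x).
Proof.
move=> df.
have cf (a b : R) : {within `[a, b], continuous f}.
  apply: continuous_subspaceT => z; apply: differentiable_continuous.
  by apply/derivable1_diffP; have := df z; case.
have [xy|/ltW yx] := leP x y.
  have [c] := MVT_segment xy (fun z _ => df z) (cf x y).
  rewrite in_itv/= => /andP[xc cy] ->; exists c => //.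
  by rewrite !ger0_norm ?subr_ge0// lerD2r.
have [c] := MVT_segment yx (fun z _ => df z) (cf y x).
rewrite in_itv/= => /andP[yc cx] fxy; exists c.
  by rewrite !ler0_norm ?subr_le0// lerN2 lerD2r.
by rewrite -opprB fxy -mulrN opprB.
Qed.

(** The mean value theorem leaves [(f' c - f' x) * (y - x)], so a Lipschitz derivative replaces a
    bound on the second derivative. *)
Lemma taylor1_lipschitz (f f' : R -> R) K x y :
  (forall z : R, is_derive z (1 : R) f (f' z)) ->
  (forall u v, `|f' u - f' v| <= K * `|u - v|) ->
  `|f y - f x - (y - x) * f' x| <= K * (y - x) ^+ 2.
Proof.
move=> df lf; have [c cx ->] := mean_value x y df.
rewrite mulrC -mulrBr normrM -real_normK ?num_real// expr2 mulrCA.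
rewrite ler_wpM2l// (le_trans (lf _ _))// ler_wpM2l//.
(* The Lipschitz bound between 1 and 0 yields [0 <= K]. *)
by have := lf 1 0; rewrite subr0 normr1 mulr1; apply: le_trans.
Qed.

Lemma lipschitz_of_derive (f f' : R -> R) K x y :
  (forall z : R, is_derive z (1 : R) f (f' z)) ->
  (forall u, `|f' u| <= K) -> `|f y - f x| <= K * `|y - x|.
Proof.
move=> df bf; have [c _ ->] := mean_value x y df.
by rewrite normrM ler_wpM2r.
Qed.

Lemma norm_sinB a b : `|sin a - sin b| <= `|a - b|.
Proof.
rewrite -[leRHS]mul1r; apply: (lipschitz_of_derive _ _ (@is_derive_sin R)) => u.
by rewrite ler_norml cos_geN1 cos_le1.
Qed.

Lemma norm_cosB a b : `|cos a - cos b| <= `|a - b|.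
Proof.
rewrite -[leRHS]mul1r; apply: (lipschitz_of_derive _ _ (@is_derive_cos R)) => u.
by rewrite normrN ler_norml sin_geN1 sin_le1.
Qed.

Lemma sin_taylor b : `|sin b - b| <= b ^+ 2.
Proof.
have h : forall u v : R, `|cos u - cos v| <= 1 * `|u - v|.
  by move=> u v; rewrite mul1r norm_cosB.
have := taylor1_lipschitz 0 b (@is_derive_sin R) h.
by rewrite sin0 cos0 !subr0 mulr1 mul1r.
Qed.

Lemma cos_taylor b : `|cos b - 1| <= b ^+ 2.
Proof.
have h : forall u v : R, `|- sin u - - sin v| <= 1 * `|u - v|.
  by move=> u v; rewrite mul1r -opprD normrN norm_sinB.
have := taylor1_lipschitz 0 b (@is_derive_cos R) h.
by rewrite sin0 cos0 mulrN mulr0 opprK addr0 subr0 mul1r.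
Qed.

Lemma expRN_taylor y : 0 <= y -> `|expR (- y) - (1 - y)| <= y ^+ 2.
Proof.
move=> y0; have h1 : 1 - y <= expR (- y) := expR_ge1Dx _.
rewrite ger0_norm ?subr_ge0// lerBlDr expRN.
have h2 : 1 + y <= expR y := expR_ge1Dx _.
have hy : 0 < 1 + y by rewrite ltr_pwDl.
rewrite (@le_trans _ _ (1 + y)^-1)//.
  by rewrite lef_pV2 ?posrE ?expR_gt0.
rewrite -[leLHS]mul1r ler_pdivrMr//; nra.
Qed.

Lemma sumsqr_gt0 beta x : 0 < beta -> 0 < beta ^+ 2 + x ^+ 2.
Proof. by move=> b0; rewrite ltr_pwDl ?sqr_ge0// exprn_gt0. Qed.

(** This function and the scaled arctangent below are the real and imaginary parts of the logarithm
    of [beta +i* x]. *)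
Lemma is_derive_half_ln beta x : 0 < beta ->
  is_derive x 1 (fun x => 2^-1 * ln (beta ^+ 2 + x ^+ 2))
    (x / (beta ^+ 2 + x ^+ 2)).
Proof.
move=> b0; have h := sumsqr_gt0 x b0.
have := is_derive1_ln h => dl.
apply: is_derive_eq.
by rewrite /GRing.scale/= /GRing.scale/=; field; rewrite lt0r_neq0.
Qed.

Lemma is_derive_scaled_atan beta x : 0 < beta ->
  is_derive x 1 (fun x => atan (x / beta)) (beta / (beta ^+ 2 + x ^+ 2)).
Proof.
move=> b0; have h := sumsqr_gt0 x b0.
apply: is_derive_eq.
rewrite /GRing.scale/=; field.
by rewrite !lt0r_neq0//= ; lra.
Qed.

End RealEstimates.

(** * Complex exponential and principal logarithm *)

Section ComplexEstimates.
Context {R : realType}.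
Implicit Types (x y a b beta theta c : R) (z w : R[i]).

Lemma complexP z w : complex.Re z = complex.Re w -> complex.Im z = complex.Im w ->
  z = w.
Proof. by case: z => ? ?; case: w => ? ? /= -> ->. Qed.

Lemma cReD z w : complex.Re (z + w) = complex.Re z + complex.Re w.
Proof. by case: z; case: w. Qed.
Lemma cImD z w : complex.Im (z + w) = complex.Im z + complex.Im w.
Proof. by case: z; case: w. Qed.
Lemma cReN z : complex.Re (- z) = - complex.Re z.
Proof. by case: z. Qed.
Lemma cImN z : complex.Im (- z) = - complex.Im z.
Proof. by case: z. Qed.
Lemma cReM z w : complex.Re (z * w) =
  complex.Re z * complex.Re w - complex.Im z * complex.Im w.
Proof. by case: z; case: w. Qed.
Lemma cImM z w : complex.Im (z * w) =
  complex.Re z * complex.Im w + complex.Im z * complex.Re w.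
Proof. by case: z; case: w. Qed.

Definition cplxE := (cReD, cImD, cReN, cImN, cReM, cImM).

Lemma normc_ge0 z : 0 <= normc z.
Proof. by case: z => a b /=; exact: sqrtr_ge0. Qed.

Lemma normc_le z : normc z <= `|complex.Re z| + `|complex.Im z|.
Proof.
case: z => a b /=; rewrite -[leRHS]ger0_norm; last by rewrite addr_ge0.
rewrite -sqrtr_sqr ler_wsqrtr// sqrrD !real_normK ?num_real//.
by have := mulr_ge0 (normr_ge0 a) (normr_ge0 b); rewrite mulr2n; lra.
Qed.

Lemma normc_geRe z : `|complex.Re z| <= normc z.
Proof. by case: z => a b /=; rewrite -sqrtr_sqr ler_wsqrtr// lerDl sqr_ge0. Qed.

Lemma normc_geIm z : `|complex.Im z| <= normc z.
Proof. by case: z => a b /=; rewrite -sqrtr_sqr ler_wsqrtr// lerDr sqr_ge0. Qed.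

Lemma normc_real c : normc c%:C = `|c|.
Proof. by rewrite /= expr0n addr0 sqrtr_sqr. Qed.

Lemma normcB z w : normc (z - w) <= normc z + normc w.
Proof. by rewrite (le_trans (le_normcD _ _))// normcN. Qed.

Lemma cexpD z w : cexp (z + w) = cexp z * cexp w.
Proof.
case: z => a b; case: w => c d; rewrite /cexp/= expRD cosD sinD.
by apply: complexP; rewrite !cplxE/=; ring.
Qed.

Lemma cexp0 : cexp (0 : R[i]) = 1.
Proof. by rewrite /cexp/= expR0 cos0 sin0; apply: complexP; rewrite !cplxE/=; ring. Qed.

Lemma cexpN z : cexp (- z) = (cexp z)^-1.
Proof.
have h : cexp (- z) * cexp z = 1 by rewrite -cexpD addNr cexp0.
have z0 : cexp z != 0.
  by apply/eqP => z0; move: h; rewrite z0 mulr0 => /esym/eqP; rewrite oner_eq0.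
by apply: (mulIf z0); rewrite h mulVf.
Qed.

Lemma normc_cexp z : normc (cexp z) = expR (complex.Re z).
Proof.
rewrite /cexp normcM normc_real ger0_norm ?expR_ge0//=.
by rewrite cos2Dsin2 sqrtr1 mulr1.
Qed.

(** A nonpositive real part gives [expR a <= 1], which makes the quadratic bound valid for large [z]
    too. The coordinate estimates already give 4; the constant 8 leaves room. *)
Lemma cexp_taylor z : complex.Re z <= 0 ->
  normc (cexp z - 1 - z) <= 8 * normc z ^+ 2.
Proof.
case: z => a b a0; set z := a +i* b.
have ha : `|a| <= normc z := normc_geRe z.
have hb : `|b| <= normc z := normc_geIm z.
have e1 : expR a <= 1 by rewrite -expR0 ler_expR.
have ea : `|expR a - (1 + a)| <= `|a| ^+ 2.
  have := @expRN_taylor _ (- a); rewrite !opprK oppr_ge0 sqrrN => /(_ a0).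
  by rewrite real_normK ?num_real.
have ea1 : `|expR a - 1| <= `|a|.
  rewrite ler0_norm ?subr_le0// ler0_norm// opprB.
  by have := expR_ge1Dx a; lra.
have hc := cos_taylor b; have hs := sin_taylor b.
rewrite -[b ^+ 2]real_normK ?num_real// in hc.
rewrite -[b ^+ 2]real_normK ?num_real// in hs.
have hRe : `|expR a * cos b - 1 - a| <= `|b| ^+ 2 + `|a| ^+ 2.
  have -> : expR a * cos b - 1 - a = expR a * (cos b - 1) + (expR a - (1 + a)).
    by ring.
  rewrite (le_trans (ler_normD _ _))// lerD// normrM (ger0_norm (expR_ge0 _)).
  by rewrite (le_trans _ hc)// ler_piMl.
have hIm : `|expR a * sin b - b| <= `|b| ^+ 2 + `|a| * `|b|.
  have -> : expR a * sin b - b = expR a * (sin b - b) + (expR a - 1) * b.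
    by ring.
  rewrite (le_trans (ler_normD _ _))// lerD// normrM ?ler_wpM2r//.
  by rewrite (ger0_norm (expR_ge0 _)) (le_trans _ hs)// ler_piMl.
rewrite (le_trans (normc_le _))// /cexp !cplxE/= !mul0r subr0 addr0 !subr0.
rewrite (le_trans (lerD hRe hIm))//.
have h1 := ler_pM (normr_ge0 a) (normr_ge0 a) ha ha.
have h2 := ler_pM (normr_ge0 b) (normr_ge0 b) hb hb.
have h3 := ler_pM (normr_ge0 a) (normr_ge0 b) ha hb.
by have := sqr_ge0 (normc z); move: h1 h2 h3; rewrite !expr2; lra.
Qed.

(* The principal logarithm of [beta +i* x] when [0 < beta]. *)
Definition clogp beta x : R[i] :=
  (2^-1 * ln (beta ^+ 2 + x ^+ 2)) +i* atan (x / beta).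

Lemma ln_sqrt x : 0 < x -> ln (Num.sqrt x) = 2^-1 * ln x.
Proof.
move=> x0; have s0 : 0 < Num.sqrt x by rewrite sqrtr_gt0.
by rewrite -[in RHS](sqr_sqrtr (ltW x0)) expr2 lnM ?posrE//; field.
Qed.

(** For positive real part the argument stays strictly between -pi/2 and pi/2, where the signed
    [acos] of [carg] agrees with an arctangent; this form can be differentiated without cases. *)
Lemma clogE beta x : 0 < beta -> clog (beta +i* x) = clogp beta x.
Proof.
move=> b0; have h := sumsqr_gt0 x b0.
rewrite /clog /clogp /cmod/= ln_sqrt//; congr (_ +i* _).
rewrite /carg /cmod/=.
have hb : beta / Num.sqrt (beta ^+ 2 + x ^+ 2) = cos (atan (x / beta)).
  rewrite cos_atan.
  have -> : 1 + (x / beta) ^+ 2 = (beta ^+ 2 + x ^+ 2) / beta ^+ 2.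
    by field; rewrite lt0r_neq0.
  rewrite sqrtrM; last exact: ltW.
  by rewrite sqrtrV ?sqr_ge0// sqrtr_sqr gtr0_norm// invfM invrK mulrC.
have hl := atan_ltpi2 (x / beta); have hg := atan_gtNpi2 (x / beta).
have pi0 := pi_gt0 R.
rewrite hb; case: ifPn => x0.
  rewrite cosK// in_itv/=; apply/andP; split; last by lra.
  by rewrite -atan0 le_atan// divr_ge0// ltW.
rewrite cosKN ?opprK//; apply/andP; split; first by lra.
by rewrite -atan0 le_atan// ler_pdivrMr// mul0r ltW// ltNge.
Qed.

Lemma norm_dclog_re beta x : 0 < beta -> `|x / (beta ^+ 2 + x ^+ 2)| <= beta^-1.
Proof.
move=> b0; have h := sumsqr_gt0 x b0.
rewrite normrM normfV (gtr0_norm h) ler_pdivrMr// mulrC ler_pdivlMr//.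
by rewrite -[x ^+ 2]real_normK ?num_real//; have := normr_ge0 x; nra.
Qed.

Lemma norm_dclog_im beta x : 0 < beta -> `|beta / (beta ^+ 2 + x ^+ 2)| <= beta^-1.
Proof.
move=> b0; have h := sumsqr_gt0 x b0.
rewrite normrM normfV (gtr0_norm h) ler_pdivrMr// mulrC ler_pdivlMr//.
by rewrite gtr0_norm//; nra.
Qed.

Lemma dclog_re_lipschitz beta x y : 0 < beta ->
  `|x / (beta ^+ 2 + x ^+ 2) - y / (beta ^+ 2 + y ^+ 2)| <= beta ^- 2 * `|x - y|.
Proof.
move=> b0; have hx := sumsqr_gt0 x b0; have hy := sumsqr_gt0 y b0.
have -> : x / (beta ^+ 2 + x ^+ 2) - y / (beta ^+ 2 + y ^+ 2) =
    ((beta ^+ 2 - x * y) / ((beta ^+ 2 + x ^+ 2) * (beta ^+ 2 + y ^+ 2))) * (x - y).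
  by field; rewrite !lt0r_neq0.
rewrite normrM ler_wpM2r// normrM normfV (gtr0_norm (mulr_gt0 hx hy)).
rewrite ler_pdivrMr ?mulr_gt0// [leRHS]mulrC ler_norml lerNl.
by rewrite !ler_pdivlMr ?exprn_gt0//; apply/andP; split; nra.
Qed.

Lemma dclog_im_lipschitz beta x y : 0 < beta ->
  `|beta / (beta ^+ 2 + x ^+ 2) - beta / (beta ^+ 2 + y ^+ 2)|
    <= beta ^- 2 * `|x - y|.
Proof.
move=> b0; have hx := sumsqr_gt0 x b0; have hy := sumsqr_gt0 y b0.
have -> : beta / (beta ^+ 2 + x ^+ 2) - beta / (beta ^+ 2 + y ^+ 2) =
    (- (beta * (x + y)) / ((beta ^+ 2 + x ^+ 2) * (beta ^+ 2 + y ^+ 2))) * (x - y).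
  by field; rewrite !lt0r_neq0.
rewrite normrM ler_wpM2r// normrM normfV (gtr0_norm (mulr_gt0 hx hy)).
rewrite ler_pdivrMr ?mulr_gt0// [leRHS]mulrC ler_norml lerNl !ler_pdivlMr ?exprn_gt0//.
(* Four nonnegative quantities from which [nra] obtains both signs of the inequality with
   denominators cleared. *)
have h1 : 0 <= (x * y) ^+ 2 by exact: sqr_ge0.
have h2 : 0 <= beta ^+ 2 * (x ^+ 2 + y ^+ 2).
  by rewrite mulr_ge0 ?addr_ge0 ?sqr_ge0.
have h3 : 0 <= beta ^+ 2 * ((beta - x) ^+ 2 + (beta - y) ^+ 2).
  by rewrite mulr_ge0 ?addr_ge0 ?sqr_ge0.
have h4 : 0 <= beta ^+ 2 * ((beta + x) ^+ 2 + (beta + y) ^+ 2).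
  by rewrite mulr_ge0 ?addr_ge0 ?sqr_ge0.
by apply/andP; split; nra.
Qed.

(** The derivative of log(beta + ix) is i / (beta + ix), written here in Cartesian form; the factor
    2 adds up the two coordinates. *)
Lemma clogp_taylor beta x y : 0 < beta ->
  normc (clogp beta y - clogp beta x
    - (y - x)%:C * ((x / (beta ^+ 2 + x ^+ 2)) +i* (beta / (beta ^+ 2 + x ^+ 2))))
  <= 2 * beta ^- 2 * (y - x) ^+ 2.
Proof.
move=> b0; rewrite (le_trans (normc_le _))// !cplxE/= !mul0r subr0 addr0.
rewrite -[leRHS]mulrA [leRHS]mulr_natl [leRHS]mulr2n lerD//.
  apply: (@taylor1_lipschitz R (fun x => 2^-1 * ln (beta ^+ 2 + x ^+ 2))
    (fun x => x / (beta ^+ 2 + x ^+ 2))) => [z|u v].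
    exact: is_derive_half_ln.
  exact: dclog_re_lipschitz.
apply: (@taylor1_lipschitz R (fun x => atan (x / beta))
  (fun x => beta / (beta ^+ 2 + x ^+ 2))) => [z|u v].
  exact: is_derive_scaled_atan.
exact: dclog_im_lipschitz.
Qed.

Lemma clogp_lipschitz beta x y : 0 < beta ->
  normc (clogp beta y - clogp beta x) <= 2 * beta^-1 * `|y - x|.
Proof.
move=> b0; rewrite (le_trans (normc_le _))// !cplxE/=.
rewrite -[leRHS]mulrA [leRHS]mulr_natl [leRHS]mulr2n lerD//.
  apply: (@lipschitz_of_derive R (fun x => 2^-1 * ln (beta ^+ 2 + x ^+ 2))
    (fun x => x / (beta ^+ 2 + x ^+ 2))) => [z|u].
    exact: is_derive_half_ln.
  exact: norm_dclog_re.
apply: (@lipschitz_of_derive R (fun x => atan (x / beta))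
  (fun x => beta / (beta ^+ 2 + x ^+ 2))) => [z|u].
  exact: is_derive_scaled_atan.
exact: norm_dclog_im.
Qed.

End ComplexEstimates.

(** * The one-step factor up to second order *)

Section OneStep.
Context {R : realType}.
Variables (k lambda beta1 beta2 p : R).
Hypotheses (hk : 0 < k) (hlambda : 0 < lambda)
  (hbeta1 : 0 < beta1) (hbeta2 : 0 < beta2) (hp : 0 <= p <= 1).
Implicit Types theta h V : R.

(** The characteristic function of the statement in Cartesian coordinates, since beta / (beta - i
    theta) = (beta^2 + i beta theta) / (beta^2 + theta^2). *)
Definition phi_dexp theta : R[i] :=
  (p * (beta1 ^+ 2 / (beta1 ^+ 2 + theta ^+ 2))
    + (1 - p) * (beta2 ^+ 2 / (beta2 ^+ 2 + theta ^+ 2)))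
  +i* (p * (beta1 * theta / (beta1 ^+ 2 + theta ^+ 2))
    - (1 - p) * (beta2 * theta / (beta2 ^+ 2 + theta ^+ 2))).

(* The function Lambda of the header. *)
Definition logpsi theta : R[i] :=
  (p * lambda / k)%:C * clogp beta1 (- theta)
  + ((1 - p) * lambda / k)%:C * clogp beta2 theta.

Let c1_ge0 : 0 <= p * lambda / k.
Proof. by case/andP: hp => p0 _; rewrite !mulr_ge0 ?invr_ge0// ltW. Qed.

Let c2_ge0 : 0 <= (1 - p) * lambda / k.
Proof.
by case/andP: hp => _ p1; rewrite !mulr_ge0 ?invr_ge0 ?subr_ge0// ltW.
Qed.

Lemma cpow_quotients theta theta' :
  (cpow (beta1 -i* theta') (p * lambda / k)
     / cpow (beta1 -i* theta) (p * lambda / k))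
  * (cpow (beta2 +i* theta') ((1 - p) * lambda / k)
     / cpow (beta2 +i* theta) ((1 - p) * lambda / k))
  = cexp (logpsi theta' - logpsi theta).
Proof.
rewrite /cpow !clogE// -!cexpN -!cexpD; congr cexp; rewrite /logpsi.
by rewrite opprD addrACA.
Qed.

(** The real part of [logpsi x] is a nonnegative combination of half the logarithms of
    [beta ^+ 2 + x ^+ 2]. The sign bounds the one-step factors by 1 in modulus, which keeps earlier
    errors from growing. *)
Lemma Re_logpsi_le x y : x ^+ 2 <= y ^+ 2 ->
  complex.Re (logpsi x - logpsi y) <= 0.
Proof.
move=> xy; rewrite cReD cReN subr_le0 /logpsi !cplxE/= !mul0r !subr0 !sqrrN.
have h beta : 0 < beta -> ln (beta ^+ 2 + x ^+ 2) <= ln (beta ^+ 2 + y ^+ 2).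
  by move=> b0; rewrite ler_ln ?posrE ?sumsqr_gt0// lerD2l.
by rewrite lerD// ler_wpM2l// ler_wpM2l ?invr_ge0// h.
Qed.

Lemma logpsi_lipschitz x y : normc (logpsi y - logpsi x) <=
  (p * lambda / k * (2 * beta1^-1) + (1 - p) * lambda / k * (2 * beta2^-1))
  * `|y - x|.
Proof.
have -> : logpsi y - logpsi x =
    (p * lambda / k)%:C * (clogp beta1 (- y) - clogp beta1 (- x))
    + ((1 - p) * lambda / k)%:C * (clogp beta2 y - clogp beta2 x).
  by rewrite /logpsi !mulrBr opprD addrACA.
rewrite (le_trans (le_normcD _ _))// [leRHS]mulrDl !normcM !normc_real.
rewrite (ger0_norm c1_ge0) (ger0_norm c2_ge0) lerD//.
  rewrite -[leRHS]mulrA ler_wpM2l// (le_trans (clogp_lipschitz _ _ _))//.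
  by rewrite -opprD normrN.
by rewrite -[leRHS]mulrA ler_wpM2l// clogp_lipschitz.
Qed.

Lemma phi_dexp_bound theta : normc (phi_dexp theta) <= 2.
Proof.
case/andP: hp => p0 p1.
have h beta : 0 < beta -> `|beta ^+ 2 / (beta ^+ 2 + theta ^+ 2)| <= 1 /\
    `|beta * theta / (beta ^+ 2 + theta ^+ 2)| <= 1.
  move=> b0; have s0 := sumsqr_gt0 theta b0.
  split; rewrite ler_norml ler_pdivrMr// ler_pdivlMr//; nra.
have [h1 h2] := h _ hbeta1; have [h3 h4] := h _ hbeta2.
have conv a b : `|a| <= 1 -> `|b| <= 1 -> `|p * a| + `|(1 - p) * b| <= 1.
  move=> a1 b1; rewrite !normrM (ger0_norm p0) (@ger0_norm _ (1 - p)) ?subr_ge0//.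
  have : p * `|a| <= p by rewrite ler_piMr.
  have : (1 - p) * `|b| <= 1 - p by rewrite ler_piMr// subr_ge0.
  by lra.
rewrite (le_trans (normc_le _))//= -[leRHS]/(1 + 1) lerD//.
  by rewrite (le_trans (ler_normD _ _))// conv.
by rewrite (le_trans (ler_normB _ _))// conv.
Qed.

(** The first two terms come from no jump and from one jump in a step of length [h]. They and the
    factor share the expansion 1 + u, with u = lambda h (phi(theta) - 1), up to order h^2.
    Frequencies are confined to [V] because [C] depends on their size. *)
Lemma step_estimate V : exists2 C, 0 <= C & forall h theta,
  0 <= h -> k * h <= 1 -> `|theta| <= V ->
  normc ((expR (- (lambda * h)))%:C
         + (lambda * h * expR (- (lambda * h)))%:C * phi_dexp theta
         - cexp (logpsi ((1 - k * h) * theta) - logpsi theta)) <= C * h ^+ 2.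
Proof.
set c1 := p * lambda / k; set c2 := (1 - p) * lambda / k.
pose K1 := c1 * (2 * beta1 ^- 2) * (k * V) ^+ 2
           + c2 * (2 * beta2 ^- 2) * (k * V) ^+ 2.
pose K2 := (c1 * (2 * beta1^-1) + c2 * (2 * beta2^-1)) * (k * V).
have K1_part c beta : 0 <= c -> 0 <= c * (2 * beta ^- 2) * (k * V) ^+ 2.
  move=> c0; rewrite mulr_ge0 ?sqr_ge0// mulr_ge0// mulr_ge0//.
  by rewrite invr_ge0 sqr_ge0.
have K1_ge0 : 0 <= K1.
  by rewrite addr_ge0// K1_part.
(* The summands bound three remainders: of the Poisson weights ([y ^+ 2] for no jump, twice that for
   one jump since phi is bounded by 2), of the exponential of [w], whose modulus is at most
   [K2 * h], and of the linearised [logpsi]. *)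
exists (3 * lambda ^+ 2 + 8 * K2 ^+ 2 + K1).
  rewrite addr_ge0// addr_ge0// mulr_ge0 ?sqr_ge0//.
move=> h theta h0 kh hV.
set theta' := (1 - k * h) * theta.
set w := logpsi theta' - logpsi theta.
set y := lambda * h.
have y0 : 0 <= y by rewrite mulr_ge0// ltW.
pose u := y%:C * (phi_dexp theta - 1).
have dtheta : theta' - theta = - (k * h * theta) by rewrite /theta'; ring.
have ndtheta : `|theta' - theta| <= k * V * h.
  rewrite dtheta normrN !normrM (gtr0_norm hk) (ger0_norm h0) mulrAC.
  by rewrite ler_wpM2r// ler_wpM2l// ltW.
have sdtheta : (theta' - theta) ^+ 2 <= (k * V) ^+ 2 * h ^+ 2.
  by rewrite -exprMn -[leLHS]real_normK ?num_real// lerXn2r ?nnegrE// (le_trans _ ndtheta).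
have s1 := sumsqr_gt0 theta hbeta1; have s2 := sumsqr_gt0 theta hbeta2.
have hwu : normc (w - u) <= K1 * h ^+ 2.
  have -> : w - u =
    c1%:C * (clogp beta1 (- theta') - clogp beta1 (- theta)
      - (- theta' - - theta)%:C * ((- theta / (beta1 ^+ 2 + (- theta) ^+ 2))
          +i* (beta1 / (beta1 ^+ 2 + (- theta) ^+ 2))))
    + c2%:C * (clogp beta2 theta' - clogp beta2 theta
      - (theta' - theta)%:C * ((theta / (beta2 ^+ 2 + theta ^+ 2))
          +i* (beta2 / (beta2 ^+ 2 + theta ^+ 2)))).
    rewrite /w /u /logpsi -/c1 -/c2.
    move: (clogp beta1 (- theta')) (clogp beta1 (- theta)) => L1 L2.
    move: (clogp beta2 theta') (clogp beta2 theta) => L3 L4.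
    rewrite [X in _ = X + _]mulrBr [X in _ = _ + X]mulrBr.
    rewrite [X in _ = X + _]addrC [X in _ = _ + X]addrC.
    rewrite -opprD dtheta sqrrN !mulrBr.
    (* What remains is the differential equation of Lambda at [theta], multiplied by [h] and written
       in coordinates. *)
    suff -> : y%:C * phi_dexp theta - y%:C * 1 =
      c1%:C * ((- - (k * h * theta))%:C * ((- theta / (beta1 ^+ 2 + theta ^+ 2))
          +i* (beta1 / (beta1 ^+ 2 + theta ^+ 2))))
      + c2%:C * ((- (k * h * theta))%:C * ((theta / (beta2 ^+ 2 + theta ^+ 2))
          +i* (beta2 / (beta2 ^+ 2 + theta ^+ 2)))) by ring.
    apply: complexP; rewrite !cplxE/= /c1 /c2 /y; field;
      by rewrite !lt0r_neq0.
  rewrite (le_trans (le_normcD _ _))// !normcM !normc_real.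
  rewrite (ger0_norm c1_ge0) (ger0_norm c2_ge0) [leRHS]mulrDl lerD//.
    rewrite -[leRHS]mulrA -[leRHS]mulrA ler_wpM2l//.
    rewrite (le_trans (clogp_taylor _ _ _))// -opprD sqrrN ler_wpM2l//.
    by rewrite mulr_ge0// invr_ge0 sqr_ge0.
  rewrite -[leRHS]mulrA -[leRHS]mulrA ler_wpM2l//.
  rewrite (le_trans (clogp_taylor _ _ _))// ler_wpM2l//.
  by rewrite mulr_ge0// invr_ge0 sqr_ge0.
have hw : normc w <= K2 * h.
  rewrite (le_trans (logpsi_lipschitz _ _))// -[leRHS]mulrA ler_wpM2l//.
  have q c beta : 0 <= c -> 0 < beta -> 0 <= c * (2 * beta^-1).
    by move=> c0 b0; rewrite mulr_ge0// mulr_ge0// invr_ge0 ltW.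
  by rewrite addr_ge0// q.
have Rew : complex.Re w <= 0.
  apply: Re_logpsi_le; rewrite exprMn ler_piMl ?sqr_ge0// expr_le1// ?subr_ge0//.
  by rewrite lerBlDr lerDl mulr_ge0// ltW.
have e1 := expRN_taylor y0.
have e2 : `|y * expR (- y) - y| <= y ^+ 2.
  rewrite -[X in _ - X]mulr1 -mulrBr normrM (ger0_norm y0) expr2 ler_wpM2l//.
  have ey1 : expR (- y) <= 1 by rewrite -[leRHS]expR0 ler_expR oppr_le0.
  rewrite ler0_norm ?subr_le0// opprB.
  by have := expR_ge1Dx (- y); lra.
have -> : (expR (- y))%:C + (y * expR (- y))%:C * phi_dexp theta - cexp w =
  (expR (- y) - (1 - y))%:C + (y * expR (- y) - y)%:C * phi_dexp theta
  - (cexp w - 1 - w) - (w - u).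
  by rewrite /u; move: (cexp w) => e; rewrite !rmorphB rmorph1; ring.
rewrite (le_trans (normcB _ _))// mulrDl lerD//.
rewrite (le_trans (normcB _ _))// mulrDl lerD//; last first.
  rewrite (le_trans (cexp_taylor Rew))// -mulrA ler_wpM2l// -exprMn.
  by rewrite lerXn2r ?nnegrE ?normc_ge0// (le_trans (normc_ge0 _) hw).
rewrite (le_trans (le_normcD _ _))// normcM !normc_real.
have := phi_dexp_bound theta; have := normc_ge0 (phi_dexp theta).
move: e1 e2; rewrite /y exprMn.
have := normr_ge0 (y * expR (- y) - y); rewrite /y.
by move: (normc _) => n; nra.
Qed.

End OneStep.

(** * The characteristic function of a double exponential jump *)

Section Density.
Context {R : realType} {d : measure_display} {T : measurableType d}.
Variable P : probability T R.
Local Notation mu := (@lebesgue_measure R).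

(** The density describes the law only as a set function, so the law is first shown absolutely
    continuous and its Radon-Nikodym derivative is then identified with [f] almost everywhere. *)
Lemma integral_density (X : {RV P >-> R}) (f g : R -> R) :
  has_density P X f -> measurable_fun setT f -> (forall x, 0 <= f x) ->
  measurable_fun setT g -> (exists M : R, forall x, `|g x| <= M) ->
  (Ex P (g \o X))%:E = (\int[mu]_x (g x * f x)%:E)%E.
Proof.
move=> dX mf f0 mg bg.
have intf : mu.-integrable setT (EFin \o f).
  apply/integrableP; split; first exact/measurable_EFinP.
  under eq_integral do rewrite /= ger0_norm//.
  by rewrite -dX// preimage_setT (le_lt_trans (probability_le1 P _))// ltry.
have dom : distribution P X `<< mu.
  apply/null_content_dominatesP => A mA A0; rewrite [LHS](dX A mA).
  by apply: null_set_integral => //; exact/measurable_EFinP/measurable_funTS.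
have bgX : brv (g \o X) by apply: brv_comp.
have mX : measurable_fun setT (X : T -> measurableTypeR R).
  by move=> _ B mB; exact: (@measurable_funPT _ _ _ _ X).
pose X' : {mfun T >-> measurableTypeR R} :=
  HB.pack (X : T -> measurableTypeR R) (isMeasurableFun.Build _ _ _ _ _ mX).
pose nu : {finite_measure set (measurableTypeR R) -> \bar R} := distribution P X'.
have dom' : nu `<< mu by exact: dom.
have intg : nu.-integrable setT (EFin \o g).
  apply: integrable_pushforward => //; first exact/measurable_EFinP.
  exact: brv_integrable bgX.
rewrite /Ex /Rintegral fineK; last first.
  by apply: integrable_fin_num => //; exact: brv_integrable bgX.
transitivity (\int[nu]_x (g x)%:E)%E.
  rewrite [RHS]integral_pushforward//; first exact/measurable_EFinP.
  exact: brv_integrable bgX.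
rewrite -(@Radon_Nikodym_change_of_variables _ _ _ nu mu dom')//=.
apply: ae_eq_integral => //.
- apply: emeasurable_funM => //; first exact/measurable_EFinP.
- by apply/measurable_EFinP; exact: measurable_funM.
under [X in ae_eq _ _ _ X]eq_fun do rewrite EFinM.
apply: ae_eqe_mul2l => /=.
rewrite Radon_NikodymE//=; case: cid => /= h [h1 h2 h3].
apply: integral_ae_eq => //=; first exact/measurable_EFinP.
by move=> E _ mE; rewrite -h3//= -dX.
Qed.

End Density.

Section DoubleExponential.
Context {R : realType}.
Local Notation mu := (@lebesgue_measure R).
Implicit Types (a b beta theta x : R).

(* Adding [1] keeps the integrand nonnegative, so that the fundamental theorem
   of calculus on a half-line for nonnegative functions applies. *)
Let wave a b theta x : R := 1 + a * cos (theta * x) + b * sin (theta * x).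

Lemma wave_ge0 a b theta x : `|a| + `|b| <= 1 -> 0 <= wave a b theta x.
Proof.
move=> ab; rewrite /wave -addrA -lerBlDl sub0r.
suff /ler_normlP[] : `|a * cos (theta * x) + b * sin (theta * x)| <= 1.
  by rewrite lerNl.
rewrite (le_trans _ ab)// (le_trans (ler_normD _ _))// !normrM.
rewrite lerD// ler_piMr// ler_norml.
  by rewrite cos_geN1 cos_le1.
by rewrite sin_geN1 sin_le1.
Qed.

(** The primitive that vanishes at infinity: minus exp(-beta x), plus the real part of beta (a - ib)
    exp((i theta - beta) x) / (i theta - beta). *)
Let prim a b beta theta x : R := expR (- (beta * x)) *
  (- 1 - (a * beta ^+ 2 + b * beta * theta) / (beta ^+ 2 + theta ^+ 2) * cos (theta * x)
   + (a * beta * theta - b * beta ^+ 2) / (beta ^+ 2 + theta ^+ 2) * sin (theta * x)).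

Lemma is_derive_prim a b beta theta x : 0 < beta ->
  is_derive x 1 (prim a b beta theta)
    (wave a b theta x * (beta * expR (- (beta * x)))).
Proof.
move=> b0; have h := sumsqr_gt0 theta b0.
rewrite /prim; apply: is_derive_eq.
rewrite /wave /GRing.scale/= /GRing.scale/=; field.
by rewrite lt0r_neq0.
Qed.

Lemma integral_wave_exponential a b beta theta : 0 < beta -> `|a| + `|b| <= 1 ->
  (\int[mu]_(x in `[0%R, +oo[) (wave a b theta x * (beta * expR (- (beta * x))))%:E
  = (1 + (a * beta ^+ 2 + b * beta * theta) / (beta ^+ 2 + theta ^+ 2))%:E)%E.
Proof.
move=> b0 ab.
pose f x := wave a b theta x * (beta * expR (- (beta * x))).
have derivP x := is_derive_prim a b theta x b0.
have cprim : continuous (prim a b beta theta).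
  move=> x; apply: differentiable_continuous.
  by apply/derivable1_diffP; case: (derivP x).
have cf : continuous f.
  move=> x; apply: differentiable_continuous; apply/derivable1_diffP.
  by rewrite /f /wave; exact: ex_derive.
rewrite (@ge0_continuous_FTC2y _ f (prim a b beta theta) 0 0).
- by rewrite /prim mulr0 oppr0 expR0 mul1r mulr0 cos0 sin0 -EFinB; congr EFin; ring.
- move=> x _; rewrite mulr_ge0 ?wave_ge0// mulr_ge0 ?expR_ge0// ltW//.
- exact: continuous_subspaceT.
- rewrite /prim.
  set A := _ / _; set B := _ / _.
  have e0 : expR (- (beta * x)) @[x --> +oo%R] --> (0 : R).
    apply: (@cvg_comp _ _ _ (fun x => beta * x) (fun x => expR (- x)) _
              (pinfty_nbhs R)); last exact: cvgr_expR.
    exact: gt0_cvgMry.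
  have cK K : K * expR (- (beta * x)) @[x --> +oo%R] --> (0 : R).
    by rewrite -[X in _ --> X](mulr0 K); apply: cvgM => //; exact: cvg_cst.
  apply: (squeeze_cvgr _ (cK (- (1 + `|A| + `|B|))) (cK (1 + `|A| + `|B|))).
  apply: nearW => x; rewrite mulNr -ler_norml normrM ger0_norm ?expR_ge0//.
  rewrite mulrC ler_wpM2r ?expR_ge0//.
  rewrite (le_trans (ler_normD _ _))// lerD//.
    rewrite (le_trans (ler_normB _ _))// lerD ?normrN1// normrM ler_piMr//.
    by rewrite ler_norml cos_geN1 cos_le1.
  by rewrite normrM ler_piMr// ler_norml sin_geN1 sin_le1.
- by move=> x _; case: (derivP x).
- exact/cvg_at_right_filter/cprim.
- by move=> x _; rewrite derive1E; apply: derive_val.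
Qed.

Lemma integral_wave_double_exponential beta1 beta2 p a b theta :
  0 < beta1 -> 0 < beta2 -> 0 <= p <= 1 -> `|a| + `|b| <= 1 ->
  (\int[mu]_x (wave a b theta x * double_exponential_pdf beta1 beta2 p x)%:E
  = (1 + a * complex.Re (phi_dexp beta1 beta2 p theta)
       + b * complex.Im (phi_dexp beta1 beta2 p theta))%:E)%E.
Proof.
move=> b1 b2 /andP[p0 p1] ab.
pose f x := wave a b theta x * double_exponential_pdf beta1 beta2 p x.
pose f1 x := p * (wave a b theta x * (beta1 * expR (- (beta1 * x)))).
pose f2 x := (1 - p) * (wave a b theta x * (beta2 * expR (beta2 * x))).
have f1_ge0 x : 0 <= f1 x.
  by rewrite mulr_ge0// mulr_ge0 ?wave_ge0// mulr_ge0 ?expR_ge0 ?ltW.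
have f2_ge0 x : 0 <= f2 x.
  by rewrite mulr_ge0 ?subr_ge0// mulr_ge0 ?wave_ge0// mulr_ge0 ?expR_ge0 ?ltW.
have fE x : f x = if 0 <= x then f1 x else f2 x.
  rewrite /f /double_exponential_pdf ltNge; case: (leP 0 x) => _ /=.
    by rewrite mulr1 mulr0 addr0 mulNr /f1; ring.
  by rewrite mulr1 mulr0 add0r /f2; ring.
have cf2 : continuous f2.
  move=> x; apply: differentiable_continuous; apply/derivable1_diffP.
  by rewrite /f2 /wave; exact: ex_derive.
have cf1 : continuous f1.
  move=> x; apply: differentiable_continuous; apply/derivable1_diffP.
  by rewrite /f1 /wave; exact: ex_derive.
have mf1 : measurable_fun setT f1 by exact: continuous_measurable_fun.
have mf2 : measurable_fun setT f2 by exact: continuous_measurable_fun.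
have mf : measurable_fun setT f.
  rewrite (_ : f = fun x => if 0 <= x then f1 x else f2 x); last exact/funext.
  by apply: measurable_fun_ifT => //; exact: measurable_fun_ler.
have -> : (\int[mu]_x (f x)%:E =
    \int[mu]_(x in `]-oo, 0%R[) (f x)%:E + \int[mu]_(x in `[0%R, +oo[) (f x)%:E)%E.
  rewrite -ge0_integral_setU//=.
  - by congr (integral _ _ _); apply/esym; rewrite -subTset => x _ /=;
      rewrite !in_itv/= andbT; case: ltP; [left|right].
  - exact/measurable_EFinP/measurable_funTS.
  - by move=> x _; rewrite lee_fin fE; case: ifP.
  - by apply/disj_setPS => x []/=; rewrite !in_itv/= andbT => /lt_geF ->.
have -> : (\int[mu]_(x in `[0%R, +oo[) (f x)%:E = \int[mu]_(x in `[0%R, +oo[)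
    (p%:E * (wave a b theta x * (beta1 * expR (- (beta1 * x))))%:E))%E.
  apply: eq_integral => x; rewrite inE/= in_itv/= andbT => x0.
  by rewrite fE x0 EFinM.
have mwave b' beta : measurable_fun setT
    (fun x => wave a b' theta x * (beta * expR (- (beta * x)))).
  apply: continuous_measurable_fun => x.
  apply: differentiable_continuous; apply/derivable1_diffP.
  by rewrite /wave; exact: ex_derive.
rewrite ge0_integralZl//=; last 2 first.
- apply/measurable_EFinP/measurable_funTS; exact: (mwave b beta1).
- by move=> x _; rewrite lee_fin mulr_ge0 ?wave_ge0// mulr_ge0 ?expR_ge0 ?ltW//.
have -> : (\int[mu]_(x in `]-oo, 0%R[) (f x)%:E = \int[mu]_(x in `]-oo, 0%R[) (f2 x)%:E)%E.
  by apply: eq_integral => x; rewrite inE/= in_itv/= fE ltNge => /negPf ->.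
rewrite integral_itv_bndo_bndc; last first.
  exact/measurable_EFinP/measurable_funTS.
rewrite -[in `]-oo, 0%R]]oppr0 ge0_integration_by_substitutionNy; last 2 first.
- exact: continuous_subspaceT.
- by move=> x _.
(* Reflecting the negative half-line changes the sign of the sine only, whence [- b]. *)
have -> : (\int[mu]_(x in `[0%R, +oo[) ((f2 \o -%R) x)%:E = \int[mu]_(x in `[0%R, +oo[)
    ((1 - p)%:E * (wave a (- b) theta x * (beta2 * expR (- (beta2 * x))))%:E))%E.
  apply: eq_integral => x _.
  by rewrite /f2/= /wave mulrN cosN sinN mulrN mulNr (mulrN beta2) EFinM.
rewrite ge0_integralZl//=; last 3 first.
- apply/measurable_EFinP/measurable_funTS; exact: (mwave (- b) beta2).
- move=> x _; rewrite lee_fin mulr_ge0 ?wave_ge0 ?normrN// mulr_ge0 ?expR_ge0 ?ltW//.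
- by rewrite lee_fin subr_ge0.
rewrite !integral_wave_exponential ?normrN//.
rewrite -EFinM -EFinM -EFinD; congr EFin.
have s1 := sumsqr_gt0 theta b1; have s2 := sumsqr_gt0 theta b2.
by rewrite /=; field; rewrite !lt0r_neq0.
Qed.

Lemma Ex_double_exponential d (T : measurableType d) (P : probability T R)
    (X : {RV P >-> R}) beta1 beta2 p theta :
  0 < beta1 -> 0 < beta2 -> 0 <= p <= 1 ->
  has_density P X (double_exponential_pdf beta1 beta2 p) ->
  Ex P (fun w => cos (theta * X w)) = complex.Re (phi_dexp beta1 beta2 p theta) /\
  Ex P (fun w => sin (theta * X w)) = complex.Im (phi_dexp beta1 beta2 p theta).
Proof.
move=> b1 b2 /[dup] p01 /andP[p0 p1] dX.
have mcos : measurable_fun setT (fun x : R => cos (theta * x)).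
  apply: continuous_measurable_fun => x; apply: differentiable_continuous.
  by apply/derivable1_diffP; exact: ex_derive.
have msin : measurable_fun setT (fun x : R => sin (theta * x)).
  apply: continuous_measurable_fun => x; apply: differentiable_continuous.
  by apply/derivable1_diffP; exact: ex_derive.
have mexp c : measurable_fun setT (fun x : R => expR (c * x)).
  apply: continuous_measurable_fun => x; apply: differentiable_continuous.
  by apply/derivable1_diffP; exact: ex_derive.
have mpdf : measurable_fun setT (double_exponential_pdf beta1 beta2 p).
  rewrite (_ : double_exponential_pdf _ _ _ = fun x : R => if 0 <= x
      then p * beta1 * expR (- beta1 * x) else (1 - p) * beta2 * expR (beta2 * x)).
    by apply: measurable_fun_ifT => //; [exact: measurable_fun_ler|
      exact: measurable_funM|exact: measurable_funM].
  apply/funext => x; rewrite /double_exponential_pdf ltNge.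
  by case: (0 <= x); rewrite /= ?mulr1 ?mulr0 ?addr0 ?add0r.
have pdf_ge0 x : 0 <= double_exponential_pdf beta1 beta2 p x.
  by rewrite addr_ge0// mulr_ge0// mulr_ge0 ?expR_ge0// mulr_ge0 ?subr_ge0// ltW.
have bcos : brv (fun w => cos (theta * X w)).
  apply: (brv_comp _ mcos) => //.
  by exists 1 => x; rewrite ler_norml cos_geN1 cos_le1.
have bsin : brv (fun w => sin (theta * X w)).
  apply: (brv_comp _ msin) => //.
  by exists 1 => x; rewrite ler_norml sin_geN1 sin_le1.
have main a b : `|a| + `|b| <= 1 ->
    1 + a * Ex P (fun w => cos (theta * X w)) + b * Ex P (fun w => sin (theta * X w))
    = 1 + a * complex.Re (phi_dexp beta1 beta2 p theta)
        + b * complex.Im (phi_dexp beta1 beta2 p theta).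
  move=> ab.
  have mwave : measurable_fun setT (wave a b theta).
    by apply: measurable_funD; [apply: measurable_funD|] => //;
      exact: measurable_funM.
  have := @integral_density _ _ _ P X _ (wave a b theta) dX mpdf pdf_ge0 mwave.
  rewrite integral_wave_double_exponential// => h.

  rewrite -(ExZ P a bcos) -(ExZ P b bsin) -[X in X + _ + _ = _](Ex_cst P 1).
  rewrite -ExD; [|exact: brv_cst|exact: brvZ].
  rewrite -ExD; [|by apply: brvD; [exact: brv_cst|exact: brvZ]|exact: brvZ].
  apply: EFin_inj; apply: h; exists 2 => x.
  rewrite /wave -addrA (le_trans (ler_normD _ _))// normr1 -[leRHS]/(1 + 1).
  rewrite lerD// (le_trans _ ab)// (le_trans (ler_normD _ _))// !normrM.
  by rewrite lerD// ler_piMr// ler_norml ?cos_geN1 ?cos_le1// sin_geN1 sin_le1.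
have n1 : `|1 : R| + `|0 : R| <= 1 by rewrite normr1 normr0 addr0.
have n2 : `|0 : R| + `|1 : R| <= 1 by rewrite normr1 normr0 add0r.
(* The two choices of coefficients isolate the cosine and the sine; the added 1 cancels. *)
split; [have := main 1 0 n1|have := main 0 1 n2]; lra.
Qed.

End DoubleExponential.

(** * The Euler scheme along one path *)

Section EulerScheme.
Context {R : realType}.
Local Notation mu := (@lebesgue_measure R).

Lemma fine_lebesgue_measure_oc (r u : R) : r <= u -> fine (mu `]r, u]) = u - r.
Proof.
move=> ru; rewrite lebesgue_measure_itv/= lte_fin; case: ltP => [//|ur].
by rewrite (@le_anti _ _ u r) ?subrr// ru ur.
Qed.

Lemma norm_Rintegral_oc_le (g : R -> R) (r u B : R) : r <= u ->
  mu.-integrable `]r, u] (EFin \o g) ->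
  (forall y, r < y <= u -> `|g y| <= B) ->
  `|\int[mu]_(y in `]r, u]) g y| <= B * (u - r).
Proof.
move=> ru ig gB; rewrite (le_trans (le_normr_Rintegral _ _))//.
have iB : mu.-integrable `]r, u] (EFin \o cst B).
  apply: measurable_bounded_integrable => //.
    by rewrite /= lebesgue_measure_itv/=; case: ifPn => // _; rewrite -EFinB ltry.
  exact: bounded_cst.
apply: (@le_trans _ _ (\int[mu]_(y in `]r, u]) B)).
  by apply: le_Rintegral => //; exact: (integrable_norm ig).
by rewrite Rintegral_cst// fine_lebesgue_measure_oc.
Qed.

Variables (k : R) (x z V : R -> R).
Hypothesis hk : 0 < k.
Hypothesis ix : forall t, 0 <= t -> mu.-integrable `[0, t] (EFin \o x).
Hypothesis xE : forall t, 0 <= t ->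
  x t - x 0 = - k * (\int[mu]_(u in `[0, t]) x u) + (z t - z 0).
Hypothesis zV : forall r u, 0 <= r -> r <= u -> `|z u - z r| <= V u - V r.

Let incr r u : 0 <= r -> r <= u ->
  x u - x r = - k * (\int[mu]_(y in `]r, u]) x y) + (z u - z r).
Proof.
move=> r0 ru; have u0 := le_trans r0 ru.
rewrite -(@Rintegral_itvB _ x (BLeft 0) (BRight u) r) ?bnd_simp//; last exact: ix.
by have := xE u0; have := xE r0; lra.
Qed.

Let ioc r u : 0 <= r -> r <= u -> mu.-integrable `]r, u] (EFin \o x).
Proof.
move=> r0 ru; apply: integrableS (ix (le_trans r0 ru)) => //.
by apply: subset_itv; rewrite bnd_simp.
Qed.

(** The error is [- k] times the integral over the step of [x y - x r]. Since [z] may jump, this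
    oscillation is controlled by the increment of [V], which dominates the variation of [z], and not
    by the step length alone. *)
Lemma euler_step_error M A r u : 0 <= r -> r <= u -> u <= A ->
  (forall y, 0 <= y -> y <= A -> `|x y| <= M) ->
  `|x u - ((1 - k * (u - r)) * x r + (z u - z r))|
    <= k * (u - r) * (k * M * (u - r) + (V u - V r)).
Proof.
move=> r0 ru uA xM.
have osc y : r < y <= u -> `|x y - x r| <= k * M * (u - r) + (V u - V r).
  move=> /andP[/ltW ry yu]; rewrite incr// (le_trans (ler_normD _ _))// lerD//.
    rewrite normrM normrN (gtr0_norm hk) -mulrA (ler_wpM2l (ltW hk))//.
    rewrite (@le_trans _ _ (M * (y - r)))//.
      apply: norm_Rintegral_oc_le => //; first exact: ioc.
      move=> v /andP[rv vy]; apply: xM.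
        exact: le_trans r0 (ltW rv).
      by rewrite (le_trans vy)// (le_trans yu).
    rewrite ler_wpM2l ?lerD2r// (le_trans _ (xM 0 _ _))//.
    by rewrite (le_trans r0)// (le_trans ru).
  rewrite (le_trans (zV _ _))// lerD2r -subr_ge0.
  by rewrite (le_trans _ (zV (le_trans r0 ry) yu)).
have ic : mu.-integrable `]r, u] (EFin \o cst (x r)).
  apply: measurable_bounded_integrable => //.
    by rewrite /= lebesgue_measure_itv/=; case: ifPn => // _; rewrite -EFinB ltry.
  exact: bounded_cst.
have -> : x u - ((1 - k * (u - r)) * x r + (z u - z r)) =
    - k * (\int[mu]_(y in `]r, u]) (x y - x r)).
  rewrite RintegralB//; last exact: ioc.
  rewrite Rintegral_cst// fine_lebesgue_measure_oc//.
  have := incr r0 ru; lra.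
rewrite normrM normrN (gtr0_norm hk) -mulrA (ler_wpM2l (ltW hk))// mulrC.
apply: norm_Rintegral_oc_le => //.
by apply: (integrableB _ (ioc r0 ru) ic).
Qed.

(** Since [0 <= q <= 1], earlier errors are not amplified. The increments of [V] in the local errors
    telescope, so a large jump costs one factor [h] once, and the global error is of order 1/n. *)
Lemma euler_scheme (a len : R) : 0 <= a -> 0 <= len ->
  exists C, forall n, (0 < n)%N -> k * (len / n%:R) <= 1 ->
  `|x (a + len) - ((1 - k * (len / n%:R)) ^+ n * x a
     + \sum_(i < n) (1 - k * (len / n%:R)) ^+ (n - i.+1)
        * (z (a + i.+1%:R * (len / n%:R)) - z (a + i%:R * (len / n%:R))))|
  <= C / n%:R.
Proof.
move=> a0 l0; set A := a + len.
have A0 : 0 <= A by rewrite addr_ge0.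
(* An a priori bound on the path, read off from the integral equation and the integrability of
   [x]. *)
pose M := `|x 0| + k * (\int[mu]_(y in `[0, A]) `|x y|) + (V A - V 0).
have xM y : 0 <= y -> y <= A -> `|x y| <= M.
  move=> y0 yA; rewrite -[x y](subrK (x 0)) addrC xE// addrA.
  rewrite (le_trans (ler_normD _ _))// lerD//; last first.
    rewrite (le_trans (zV _ _))// lerD2r -subr_ge0.
    by rewrite (le_trans _ (zV y0 yA)).
  rewrite (le_trans (ler_normD _ _))// lerD2l normrM normrN (gtr0_norm hk).
  rewrite (ler_wpM2l (ltW hk))// (le_trans (le_normr_Rintegral _ _))//; first exact: ix.
  rewrite -subr_ge0.
  have iN : mu.-integrable `[0, A] (EFin \o (fun y => `|x y|)).
    exact: integrable_norm (ix A0).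
  rewrite (@Rintegral_itvB _ (fun y => `|x y|) (BLeft 0) (BRight A) y)//.
  exact: Rintegral_ge0.
(* This is [n] times the bound [err] at [j = n], where [n%:R * h = len]. *)
exists (k * len * (k * M * len + (V A - V a))) => n n0 kh1.
set h := len / n%:R; set q := 1 - k * h.
have h0 : 0 <= h by rewrite divr_ge0.
have nh : n%:R * h = len by rewrite /h mulrCA divff ?mulr1// pnatr_eq0 -lt0n.
have q01 : 0 <= q <= 1.
  rewrite subr_ge0 kh1/= lerBlDr lerDl mulr_ge0// ltW//.
pose t i := a + i%:R * h.
have t0 i : 0 <= t i by rewrite addr_ge0// mulr_ge0.
have tS i : t i.+1 - t i = h by rewrite /t -natr1; ring.
have tSle i : t i <= t i.+1 by rewrite -subr_ge0 tS.
have tA i : (i <= n)%N -> t i <= A.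
  by move=> ni; rewrite lerD2l -nh ler_wpM2r// ler_nat.
pose e i := z (t i.+1) - z (t i).
pose E j := q ^+ j * x a + \sum_(i < j) q ^+ (j - i.+1) * e i.
have ES j : E j.+1 = q * E j + e j.
  rewrite /E big_ord_recr/= subnn expr0 mul1r mulrDr mulrA -exprS addrA.
  congr (_ + _ + _); rewrite mulr_sumr; apply: eq_bigr => i _.
  by rewrite mulrA -exprS subSn.
have err j : (j <= n)%N ->
    `|x (t j) - E j| <= k * h * (k * M * (j%:R * h) + (V (t j) - V (t 0))).
  elim: j => [_|j ih jn].
    rewrite /E big_ord0 addr0 expr0 mul1r /t mul0r addr0 !subrr normr0.
    by rewrite mulr0 addr0 mulr0.
  have {}ih := ih (ltnW jn).
  have st := euler_step_error (t0 j) (tSle j) (tA _ jn) xM.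
  rewrite tS -/q -/(e j) in st.
  have -> : x (t j.+1) - E j.+1 =
      (x (t j.+1) - (q * x (t j) + e j)) + q * (x (t j) - E j).
    by rewrite ES; ring.
  rewrite (le_trans (ler_normD _ _))// normrM; case/andP: q01 => q0 q1.
  rewrite (ger0_norm q0).
  have := ler_piMl (normr_ge0 (x (t j) - E j)) q1.
  rewrite -natr1; move: ih st; lra.
have tn : t n = A by rewrite /t nh.
have := err n (leqnn n); rewrite tn /t mul0r addr0 nh /E => /le_trans; apply.
rewrite le_eqVlt; apply/orP; left; apply/eqP; rewrite /h; ring.
Qed.

End EulerScheme.

Lemma big_sum_index (I J : Type) (V : Type) (idx : V) (op : Monoid.com_law idx)
    (s : seq (I + J)) (F : I + J -> V) :
  \big[op/idx]_(x <- s) F x =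
  op (\big[op/idx]_(i <- pmap (fun x => if x is inl i then Some i else None) s)
        F (inl i))
     (\big[op/idx]_(j <- pmap (fun x => if x is inr j then Some j else None) s)
        F (inr j)).
Proof.
elim: s => [|[i|j] s ih] /=; first by rewrite !big_nil Monoid.mulm1.
  by rewrite !big_cons ih Monoid.mulmA.
by rewrite !big_cons ih Monoid.mulmCA.
Qed.

(** * Conditioning on the past along a time grid *)

Section MutualIndependenceSum.
Context {R : realType} {d : measure_display} {T : measurableType d}.
Variable P : probability T R.

(** A finite intersection splits into one event of [SF] and one of [SG], as both are stable under
    intersection; their independence separates the two, and each family is then treated alone. *)
Lemma mutually_independent_sum (I J : eqType) (F : I -> set (set T))
    (G : J -> set (set T)) (SF SG : set (set T)) :
  mutually_independent P F -> mutually_independent P G ->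
  independent2 P SF SG ->
  (forall i, F i `<=` SF) -> (forall j, G j `<=` SG) ->
  SF setT -> SG setT -> setI_closed SF -> setI_closed SG ->
  mutually_independent P (fun x : I + J => match x with inl i => F i | inr j => G j end).
Proof.
move=> iF iG iFG FS GS FT GT FI GI s A us sA.
rewrite !big_sum_index/=.
set sl := pmap _ s; set sr := pmap _ s.
have msl i : i \in sl -> inl i \in s.
  by rewrite mem_pmap => /mapP[[a|b] // sx [->]].
have msr j : j \in sr -> inr j \in s.
  by rewrite mem_pmap => /mapP[[a|b] // sx [->]].
have usl : uniq sl by apply: pmap_uniq us => -[a|b].
have usr : uniq sr by apply: pmap_uniq us => -[a|b].
rewrite iFG.
- congr (_ * _)%E.
    by apply: (iF sl (fun i => A (inl i))) => // i /msl /sA.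
  by apply: (iG sr (fun j => A (inr j))) => // j /msr /sA.
- rewrite big_seq_cond; elim/big_ind : _ => // i; rewrite andbT => /msl /sA.
  exact: FS.
- rewrite big_seq_cond; elim/big_ind : _ => // j; rewrite andbT => /msr /sA.
  exact: GS.
Qed.

End MutualIndependenceSum.

Section AdaptedClosure.
Context {R : realType} {d : measure_display} {T : measurableType d}.
Context {I : eqType}.
Variable W : I -> T -> R.

Lemma adapted_sub s s' (H : T -> R) : {subset s <= s'} ->
  adapted W s H -> adapted W s' H.
Proof.
move=> ss' aH _ B mB; have := aH measurableT B mB.
apply: sub_sigma_algebra2 => X [i /= si hX]; exists i => //=.
exact: ss'.
Qed.

Lemma adapted_cst s c : adapted W s (fun=> c).
Proof. exact: measurable_cst. Qed.

Lemma adaptedD s F G : adapted W s F -> adapted W s G ->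
  adapted W s (fun w => F w + G w).
Proof. by move=> aF aG; exact: measurable_funD. Qed.

Lemma adaptedM s F G : adapted W s F -> adapted W s G ->
  adapted W s (fun w => F w * G w).
Proof. by move=> aF aG; exact: measurable_funM. Qed.

Lemma adapted_comp s F (g : R -> R) : measurable_fun setT g -> adapted W s F ->
  adapted W s (g \o F).
Proof. by move=> mg aF; apply: measurableT_comp. Qed.

Lemma adapted_sum (A : Type) s (r : seq A) (F : A -> T -> R) :
  (forall i, adapted W s (F i)) ->
  adapted W s (fun w => \sum_(i <- r) F i w).
Proof.
move=> aF; elim: r => [|i r ih].
  by under eq_fun do rewrite big_nil; exact: adapted_cst.
by under eq_fun do rewrite big_cons; exact: adaptedD.
Qed.

End AdaptedClosure.

Section CountSplit.
Context {R : realType} {d : measure_display} {T : measurableType d}.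
Variable P : probability T R.

Lemma measurable_bool_num (b : T -> bool) : measurable_fun setT b ->
  measurable_fun setT (fun w => (b w)%:R : R).
Proof.
by move=> mb; apply: (@measurableT_comp _ _ _ _ _ _ (fun b : bool => b%:R : R)).
Qed.

Lemma brv_bool (b : T -> bool) : measurable_fun setT b ->
  brv (fun w => (b w)%:R : R).
Proof.
move=> mb; split; first exact: measurable_bool_num.
by exists 1 => w; case: (b w); rewrite ?normr1 ?normr0.
Qed.

Lemma measurable_nat_pred (n : T -> nat) (p : pred nat) : measurable_fun setT n ->
  measurable_fun setT (fun w => p (n w)).
Proof. by move=> mn; apply: (@measurableT_comp _ _ _ _ _ _ p). Qed.

(** The partial sums over [q < Q] converge by dominated convergence, because [n] takes finite
    values. This undoes the case distinction on the number of past jumps, which is why [c] is the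
    same for all [q]. *)
Lemma Ex_count_split (n : T -> nat) (F H : T -> R) (c : R) :
  measurable_fun setT n -> brv F -> brv H ->
  (forall q, Ex P (fun w => (n w == q)%:R * F w)
           = c * Ex P (fun w => (n w == q)%:R * H w)) ->
  Ex P F = c * Ex P H.
Proof.
move=> mn bF bH FH.
have cvgE G : brv G -> \sum_(q < Q) Ex P (fun w => (n w == q)%:R * G w)
    @[Q --> \oo] --> Ex P G.
  move=> bG; have bq q : brv (fun w => (n w == q)%:R * G w).
    by apply: brvM => //; apply: brv_bool; exact: (@measurable_nat_pred n (pred1 q)).
  have [mG [B hB]] := bG.
  rewrite (_ : (fun Q => _) = fun Q => Ex P (fun w => (n w < Q)%:R * G w)).
    apply: (@Ex_cvg _ _ _ _ _ _ B) => //.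
    - move=> Q; apply: measurable_funM => //; apply: measurable_bool_num.
      exact: (@measurable_nat_pred n (fun i => i < Q)%N).
    - move=> Q w; rewrite normrM (le_trans _ (hB w))// ler_piMl//.
      by case: (_ < _)%N; rewrite ?normr1 ?normr0.
    - apply: aeW => w; apply: cvg_near_cst; near=> Q.
      rewrite (_ : (n w < Q)%N = true) ?mul1r//.
      by near: Q; exact: nbhs_infty_gt.
  apply/funext => Q; rewrite -(Ex_sum _ (index_enum _))//.
  congr Ex; apply/funext => w; rewrite -mulr_suml; congr (_ * _).
  have [nQ|Qn] := ltnP (n w) Q.
    rewrite (bigD1 (Ordinal nQ))//= eqxx big1 ?addr0// => i /eqP ni.
    by case: eqP => // ne; case: ni; apply: val_inj; rewrite /= ne.
  rewrite big1// => i _; case: eqP => // ne.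
  by have := ltn_ord i; rewrite -ne ltnNge Qn.
have h1 := cvgE _ bF.
have h2 : \sum_(q < Q) Ex P (fun w => (n w == q)%:R * F w) @[Q --> \oo] --> c * Ex P H.
  under eq_fun do under eq_bigr do rewrite FH.
  by under eq_fun do rewrite -mulr_sumr; apply: cvgM; [exact: cvg_cst|exact: cvgE].
exact: (cvg_unique _ h1 h2).
Unshelve. all: by end_near.
Qed.

End CountSplit.

Section Grid.
Context {R : realType} {d : measure_display} {T : measurableType d}.
Variable P : probability T R.
Variables (lambda : R) (hlambda : 0 < lambda) (N : R -> {RV P >-> nat})
  (J : nat -> {RV P >-> R}) (Z : R -> {RV P >-> R}).
Hypothesis hN : poisson_process lambda N.
Hypothesis hJ : mutually_independent P (fun n => g_sigma_algebra_preimage (J n)).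
Hypothesis hNJ : independent2 P
  (sigma_family [set t : R | 0 <= t] (fun t => N t : T -> nat))
  (sigma_family [set: nat] (fun n => J n : T -> R)).
Hypothesis hZ : forall t w, 0 <= t -> Z t w = \sum_(n < N t w) J n w.
Variables (M : nat) (t : nat -> R).
Hypotheses (t0 : t 0%N = 0) (tS : forall i, t i <= t i.+1).

Let t_ge0 i : 0 <= t i.
Proof. by elim: i => [|i ih]; rewrite ?t0// (le_trans ih). Qed.

(** Increments of [N] and jumps form one family of real variables, so that a single product rule
    covers both. The increments are finitely many, as in [poisson_process]; all jumps are kept
    because their number up to a given time is not bounded. *)
Definition gridW (x : 'I_M + nat) : T -> R :=
  match x with
  | inl i => fun w => (N (t i.+1) w)%:R - (N (t i) w)%:R
  | inr j => J j
  end.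

Lemma measurable_natmul (X : {RV P >-> nat}) :
  measurable_fun setT (fun w => (X w)%:R : R).
Proof.
apply: (@measurableT_comp _ _ _ _ _ _ (fun n : nat => n%:R : R)) => //.
Qed.

Lemma measurable_gridW x : measurable_fun setT (gridW x).
Proof.
case: x => [i|j] //=; apply: measurable_funB; exact: measurable_natmul.
Qed.

Lemma gridW_independent :
  mutually_independent P (fun x => g_sigma_algebra_preimage (gridW x)).
Proof.
have [_ _ incN] := hN.
have iI (G : set (set T)) : setI_closed <<s G >>.
  move=> A B sA sB.
  exact: (@measurableI _ (g_sigma_algebraType G) A B).
have iT (G : set (set T)) : <<s G >> setT.
  exact: (@measurableT _ (g_sigma_algebraType G)).
have := @mutually_independent_sum _ _ _ P 'I_M nat _ _ _ _
  (incN M t (t_ge0 0) tS) hJ hNJ.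
move=> h s A us sA; apply: h => //; last 1 first.
- by move=> [i|j] /sA.
- move=> i _ [B mB <-]; rewrite setTI.
  pose G := \bigcup_(i in [set t : R | 0 <= t]) g_sigma_algebra_preimage (N i : T -> nat).
  have mN u : 0 <= u ->
      measurable_fun setT ((fun w => (N u w)%:R) : g_sigma_algebraType G -> R).
    move=> u0; apply: (@measurableT_comp _ _ _ _ _ _ (fun n : nat => n%:R : R)) => //.
    move=> _ C mC; apply: sub_sigma_algebra; exists u => //.
    by exists C.
  have mD : measurable_fun setT
      ((fun w => (N (t i.+1) w)%:R - (N (t i) w)%:R) : g_sigma_algebraType G -> R).
    by apply: measurable_funB; exact: mN.
  by have := mD measurableT B mB; rewrite setTI.
- move=> j _ [B mB <-]; apply: sub_sigma_algebra; exists j => //.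
  by exists B.
- exact: iT.
- exact: iT.
- exact: iI.
- exact: iI.
Qed.

(** Here [m] counts time steps and [q] counts jumps, as separate parameters; in [known], [q] becomes
    the value of [N (t m)]. *)
Definition past (m q : nat) : seq ('I_M + nat)%type :=
  map inl [seq i : 'I_M <- enum 'I_M | (i < m)%N] ++ map inr (iota 0 q).

Lemma past_uniq m q : uniq (past m q).
Proof.
rewrite cat_uniq map_inj_uniq; last by move=> ? ? [].
rewrite map_inj_uniq; last by move=> ? ? [].
rewrite filter_uniq ?enum_uniq// iota_uniq andbT/=.
by apply/hasPn => x /mapP[j _ ->]; apply/negP => /mapP[].
Qed.

Lemma mem_past_inl m q (i : 'I_M) : (inl i \in past m q) = (i < m)%N.
Proof.
rewrite mem_cat; apply/orP/idP => [[/mapP[i' + [->]]|/mapP[]//]|im].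
  by rewrite mem_filter => /andP[].
by left; apply/mapP; exists i => //; rewrite mem_filter im mem_enum.
Qed.

Lemma mem_past_inr m q j : (inr j \in past m q) = (j < q)%N.
Proof.
rewrite mem_cat; apply/orP/idP => [[/mapP[]//|/mapP[j' + [->]]]|jq].
  by rewrite mem_iota.
by right; apply/mapP; exists j => //; rewrite mem_iota.
Qed.

(** Stands in for [N (t m)], which is no member of [gridW] and equals this sum only on paths that
    start at 0. *)
Definition partial_count m w : R := \sum_(i < M | (i < m)%N) gridW (inl i) w.

Lemma adapted_partial_count m i q : (i <= m)%N ->
  adapted gridW (past m q) (partial_count i).
Proof.
move=> im; have -> : partial_count i = fun w =>
    \sum_(a < M) if (a < i)%N then gridW (inl a) w else 0.
  by apply/funext => w; exact: big_mkcond.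
apply: adapted_sum => a; case: (boolP (a < i)%N) => ai; last exact: adapted_cst.
apply: adapted_base; rewrite mem_past_inl; exact: leq_trans ai im.
Qed.

Lemma partial_countE m w : (m <= M)%N -> N (t 0) w = 0%N ->
  partial_count m w = (N (t m) w)%:R.
Proof.
move=> mM N0; rewrite /partial_count /gridW.
rewrite (big_ord_narrow mM (F := fun i : 'I_M => (N (t i.+1) w)%:R - (N (t i) w)%:R)).
rewrite /= -(big_mkord xpredT (fun i => (N (t i.+1) w)%:R - (N (t i) w)%:R : R)).
by rewrite telescope_sumr// N0 subr0.
Qed.

Definition good w := N (t 0) w = 0%N /\ forall i, (N (t i) w <= N (t i.+1) w)%N.

Lemma ae_good : {ae P, forall w, good w}.
Proof.
have [aeN _ _] := hN; apply: filterS aeN => w [N0 Nm _].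
by split => [|i]; [rewrite t0|exact: Nm].
Qed.

Lemma good_le w i j : good w -> (i <= j)%N -> (N (t i) w <= N (t j) w)%N.
Proof.
move=> [_ h]; elim: j => [|j ih]; first by rewrite leqn0 => /eqP ->.
by rewrite leq_eqVlt => /predU1P[->//|/ih/leq_trans]; apply.
Qed.

(* [F] is determined by the history up to time [t m]. The number of jumps
   involved is random, whence the case distinction on [N (t m)]. *)
Definition known m (F : T -> R) := forall q, exists2 Fq,
  adapted gridW (past m q) Fq &
  forall w, good w -> N (t m) w = q -> F w = Fq w.

Lemma known_cst m c : known m (fun=> c).
Proof. by move=> q; exists (fun=> c) => //; exact: adapted_cst. Qed.

Lemma knownD m F G : known m F -> known m G -> known m (fun w => F w + G w).
Proof.
move=> kF kG q; have [Fq aF hF] := kF q; have [Gq aG hG] := kG q.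
exists (fun w => Fq w + Gq w); first exact: adaptedD.
by move=> w gw Nq; rewrite hF// hG.
Qed.

Lemma knownM m F G : known m F -> known m G -> known m (fun w => F w * G w).
Proof.
move=> kF kG q; have [Fq aF hF] := kF q; have [Gq aG hG] := kG q.
exists (fun w => Fq w * Gq w); first exact: adaptedM.
by move=> w gw Nq; rewrite hF// hG.
Qed.

Lemma known_comp m F (g : R -> R) : measurable_fun setT g -> known m F ->
  known m (fun w => g (F w)).
Proof.
move=> mg kF q; have [Fq aF hF] := kF q.
exists (g \o Fq); first exact: adapted_comp.
by move=> w gw Nq /=; rewrite hF.
Qed.

Lemma known_sum (A : Type) m (r : seq A) (Q : pred A) (F : A -> T -> R) :
  (forall i, Q i -> known m (F i)) ->
  known m (fun w => \sum_(i <- r | Q i) F i w).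
Proof.
move=> kF; elim: r => [|i r ih].
  by under eq_fun do rewrite big_nil; exact: known_cst.
under eq_fun do rewrite big_cons; case: (boolP (Q i)) => // Qi.
by apply: knownD => //; exact: kF.
Qed.

(* Before time [t m] with [N (t m) = q] only the first [q] jumps matter. *)
Lemma known_Z m i : (i <= m)%N -> (m <= M)%N -> known m (Z (t i)).
Proof.
(* On good paths [g j (partial_count i w)] is 1 exactly when jump [j] has occurred by [t i]; a sum
   over the first [q] jumps thus replaces one of random length. *)
move=> im mM q; pose g (j : nat) (x : R) : R := ((j%:R < x)%R : bool)%:R.
exists (fun w => \sum_(j <- iota 0 q) g j (partial_count i w) * J j w).
  have -> : iota 0 q = [seq nat_of_ord j | j <- enum 'I_q] by rewrite val_enum_ord.
  under eq_fun do rewrite big_map.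
  apply: adapted_sum => j; apply: adaptedM.
    apply: (@adapted_comp _ _ _ _ _ _ (partial_count i) (g j)).
      rewrite /g; apply: (@measurableT_comp _ _ _ _ _ _ (fun b : bool => b%:R : R)) => //.
      exact: measurable_fun_ltr.
    exact: adapted_partial_count.
  by apply: (@adapted_base _ _ _ _ gridW _ (inr (j : nat))); rewrite mem_past_inr.
move=> w gw Nq; rewrite hZ//.
rewrite (partial_countE (leq_trans im mM) (proj1 gw)).
rewrite -(big_mkord xpredT (fun j => J j w)) /g.
have Niq : (N (t i) w <= q)%N by rewrite -Nq good_le.
have -> : iota 0 q = index_iota 0 q by rewrite /index_iota subn0.
rewrite [RHS](big_cat_nat (n := N (t i) w))//=.
rewrite [X in _ = _ + X]big_nat_cond [X in _ = _ + X]big1 ?addr0.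
  by rewrite !big_mkord; apply: eq_bigr => j _; rewrite ltr_nat ltn_ord mul1r.
by move=> j; rewrite andbT => /andP[Nj _]; rewrite ltr_nat ltnNge Nj mul0r.
Qed.

Definition jumped m l w : bool := (N (t m.+1) w == N (t m) w + l)%N.

Lemma jumpedE (m : 'I_M) (l : nat) w :
  (gridW (inl m) w == l%:R) = jumped m l w.
Proof. by rewrite /= subr_eq -natrD eqr_nat addnC. Qed.

Lemma measurable_jumped (m : 'I_M) l : measurable_fun setT (jumped m l).
Proof.
rewrite (_ : jumped _ _ = fun w => gridW (inl m) w == l%:R); last first.
  by apply/funext => w; rewrite jumpedE.
by apply: measurable_fun_eqr => //; exact: measurable_gridW.
Qed.

Lemma Ex_jumped (m : 'I_M) l : t m < t m.+1 ->
  Ex P (fun w => (jumped m l w)%:R) = poisson_pmf (lambda * (t m.+1 - t m)) l.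
Proof.
move=> tm; have [_ pN _] := hN; have := pN _ _ (t_ge0 m) tm l.
set E := [set w | _] => PE.
have mE : measurable E.
  rewrite (_ : E = jumped m l @^-1` [set true]).
    by rewrite -[X in measurable X]setTI; exact: measurable_jumped.
  by apply/seteqP; split => w /eqP.
transitivity (Ex P (\1_E : T -> R)); last by rewrite Ex_indic// PE.
congr Ex; apply/funext => w; rewrite indicE; congr (_%:R); congr nat_of_bool.
by apply/eqP/idP => [h|/set_mem //]; exact/mem_set.
Qed.

(** On [N (t m) = q] the variable [H] depends on [past m q] only, while the increment over the step
    and [J q] are two further members of the family; the product rule is applied once for each. Here
    [g] acts on the first jump after [t m], and its mean [c] is common to all jumps. *)
Lemma Ex_known_increment (m : 'I_M) l (g : R -> R) (c : R) (H F : T -> R) :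
  t m < t m.+1 -> brv H -> known m H -> brv F ->
  measurable_fun setT g -> (exists B : R, forall x, `|g x| <= B) ->
  (forall q, Ex P (g \o J q) = c) ->
  (forall w, good w -> jumped m l w -> F w = g (J (N (t m) w) w)) ->
  Ex P (fun w => H w * ((jumped m l w)%:R * F w))
    = poisson_pmf (lambda * (t m.+1 - t m)) l * c * Ex P H.
Proof.
move=> tm bH kH bF mg bg gc Fg.
have mNm : measurable_fun setT (N (t m) : T -> nat) by [].
have bj : brv (fun w => (jumped m l w)%:R : R) by apply: brv_bool; exact: measurable_jumped.
apply: (Ex_count_split mNm) => //; first by apply: brvM => //; exact: brvM.
move=> q; have [Hq aHq hHq] := kH q.
have [mH [B hB]] := bH.
(* [Hq] agrees with [H] only on good paths with [N (t m) = q] and may be unbounded elsewhere;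
   cutting it off at the bound of [H] changes nothing where they agree. *)
pose clamp (x : R) := Num.max (- B) (Num.min B x).
have mclamp : measurable_fun setT clamp.
  by apply: measurable_maxr => //; exact: measurable_minr.
have clampE x : `|x| <= B -> clamp x = x.
  rewrite ler_norml => /andP[xl xr]; rewrite /clamp (min_idPr xr).
  by rewrite (max_idPr xl).
have B0 (w : T) : 0 <= B by exact: le_trans (normr_ge0 _) (hB w).
have bclamp x (w : T) : `|clamp x| <= B.
  rewrite /clamp ler_norml; apply/andP; split.
    by rewrite le_max lexx.
  by rewrite ge_max ge_min lexx/= andbT (@le_trans _ _ 0)// ?oppr_le0 (B0 w).
pose eqn (n : nat) (x : R) : R := (x == n%:R)%:R.
have meqn n : measurable_fun setT (eqn n).
  by apply: measurable_bool_num; exact: measurable_fun_eqr.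
have beqn n x : `|eqn n x| <= 1.
  by rewrite /eqn; case: (_ == _); rewrite ?normr1 ?normr0.
(* An adapted version of [H] times the indicator of [N (t m) = q], equal to it almost surely. *)
pose G w := eqn q (partial_count m w) * clamp (Hq w).
have aG : adapted gridW (past m q) G.
  apply: adaptedM; last exact: (adapted_comp mclamp aHq).
  by apply: (@adapted_comp _ _ _ _ _ _ (partial_count m)) => //; exact: adapted_partial_count.
have mG : measurable_fun setT G := adapted_measurable measurable_gridW aG.
have bG : brv G.
  split => //; exists B => w; rewrite normrM (le_trans _ (bclamp (Hq w) w))//.
  by rewrite ler_piMl.
have mM : (m <= M)%N by exact: ltnW.
have uD : uniq (inl m :: past m q) by rewrite /= past_uniq mem_past_inl ltnn.
have uJ : uniq (inr q :: inl m :: past m q).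
  by rewrite /= in_cons/= mem_past_inl mem_past_inr !ltnn past_uniq.
have aGD : adapted gridW (inl m :: past m q) (fun w => G w * eqn l (gridW (inl m) w)).
  apply: adaptedM.
    by apply: adapted_sub aG => x xs; rewrite inE xs orbT.
  apply: (@adapted_comp _ _ _ _ _ _ (gridW (inl m))) => //.
  by apply: adapted_base; rewrite inE eqxx.
have bD : brv (fun w => eqn l (gridW (inl m) w)).
  apply: brv_comp => //; first exact: measurable_gridW.
  by exists 1.
have E1 := Ex_adaptedM measurable_gridW gridW_independent uD aG bG (meqn l)
  (ex_intro _ 1 (beqn l)).
have E2 := Ex_adaptedM measurable_gridW gridW_independent uJ aGD (brvM bG bD) mg bg.
have EJ : Ex P (eqn l \o gridW (inl m)) = poisson_pmf (lambda * (t m.+1 - t m)) l.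
  rewrite -Ex_jumped//; congr Ex; apply/funext => w.
  by rewrite /= /eqn -jumpedE.
have EG : Ex P G = Ex P (fun w => (N (t m) w == q)%:R * H w).
  apply: Ex_ae => //.
    apply: measurable_funM => //; apply: measurable_bool_num.
    exact: (@measurable_nat_pred _ _ _ (pred1 q)).
  apply: filterS ae_good => w gw.
  rewrite /G /eqn partial_countE//; last by case: gw.
  rewrite eqr_nat; case: eqP => [Nq|_]; last by rewrite !mul0r.
  by rewrite !mul1r hHq// clampE// -hHq.
rewrite -EG -EJ [X in X * _ * _]EJ mulrAC -EJ.
rewrite [X in _ = X * _]mulrC -E1 -(gc q) -E2.
apply: Ex_ae => //.
- apply: measurable_funM; last by case: (brvM bH (brvM bj bF)).
  apply: measurable_bool_num; exact: (@measurable_nat_pred _ _ _ (pred1 q)).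
- apply: measurable_funM; first by case: (brvM bG bD).
  by apply: measurableT_comp.
apply: filterS ae_good => w gw.
rewrite /G /eqn jumpedE partial_countE//; last by case: gw.
rewrite eqr_nat; case: eqP => [Nq|_]; last by rewrite !mul0r.
rewrite !mul1r -hHq// clampE//.
by case: (boolP (jumped m l w)) => jw; rewrite ?mul0r ?mulr0 ?mul0r// !mul1r !mulr1 Fg// Nq.
Qed.

End Grid.

(** * One step of the scheme *)

Section ComplexExpectation.
Context {R : realType} {d : measure_display} {T : measurableType d}.
Variable P : probability T R.
Implicit Types F G H : T -> R[i].

Definition Ec F : R[i] :=
  Ex P (fun w => complex.Re (F w)) +i* Ex P (fun w => complex.Im (F w)).

Definition brvC F :=
  brv (fun w => complex.Re (F w)) /\ brv (fun w => complex.Im (F w)).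

Lemma eq_Ec F G : F =1 G -> Ec F = Ec G.
Proof. by move=> FG; congr Ec; apply/funext. Qed.

Lemma brvCD F G : brvC F -> brvC G -> brvC (fun w => F w + G w).
Proof.
move=> [F1 F2] [G1 G2]; split.
  by under eq_fun do rewrite cReD; exact: brvD.
by under eq_fun do rewrite cImD; exact: brvD.
Qed.

Lemma brvCM F G : brvC F -> brvC G -> brvC (fun w => F w * G w).
Proof.
move=> [F1 F2] [G1 G2]; split.
  by under eq_fun do rewrite cReM; apply: brvB; exact: brvM.
by under eq_fun do rewrite cImM; apply: brvD; exact: brvM.
Qed.

Lemma brvC_real (f : T -> R) : brv f -> brvC (fun w => (f w)%:C).
Proof. by move=> bf; split => //=; exact: brv_cst. Qed.

Lemma EcD F G : brvC F -> brvC G -> Ec (fun w => F w + G w) = Ec F + Ec G.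
Proof.
move=> [F1 F2] [G1 G2]; rewrite /Ec; apply: complexP; rewrite !cplxE/= -ExD//.
  by congr Ex; apply/funext => w; rewrite cReD.
by congr Ex; apply/funext => w; rewrite cImD.
Qed.

Lemma normc_Ec_le F (g : T -> R) : brvC F -> brv g ->
  (forall w, normc (F w) <= g w) -> normc (Ec F) <= 2 * Ex P g.
Proof.
move=> [F1 F2] bg Fg; rewrite (le_trans (normc_le _))// mulr_natl mulr2n lerD//.
  by apply: le_norm_Ex => // w; exact: le_trans (normc_geRe _) (Fg w).
by apply: le_norm_Ex => // w; exact: le_trans (normc_geIm _) (Fg w).
Qed.

Definition expi (x : R) : R[i] := cexp (0 +i* x).

Lemma expiE x : expi x = cos x +i* sin x.
Proof.
by rewrite /expi /cexp/= expR0; apply: complexP; rewrite !cplxE/=; ring.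
Qed.

Lemma normc_expi x : normc (expi x) = 1.
Proof. by rewrite /expi normc_cexp expR0. Qed.

Lemma expiD x y : expi (x + y) = expi x * expi y.
Proof. by rewrite /expi -cexpD; congr cexp; apply: complexP; rewrite !cplxE/= ?addr0. Qed.

Lemma measurable_cosR : measurable_fun setT (@cos R).
Proof. by apply: continuous_measurable_fun; exact: continuous_cos. Qed.

Lemma measurable_sinR : measurable_fun setT (@sin R).
Proof. by apply: continuous_measurable_fun; exact: continuous_sin. Qed.

Lemma norm_cos_le1 (x : R) : `|cos x| <= 1.
Proof. by rewrite ler_norml cos_geN1 cos_le1. Qed.

Lemma norm_sin_le1 (x : R) : `|sin x| <= 1.
Proof. by rewrite ler_norml sin_geN1 sin_le1. Qed.

Lemma brvC_expi (X : T -> R) : measurable_fun setT X -> brvC (fun w => expi (X w)).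
Proof.
move=> mX; split.
  under eq_fun do rewrite expiE/=.
  apply: (@brv_comp _ _ _ (@cos R)) => //; first exact: measurable_cosR.
  by exists 1 => x; exact: norm_cos_le1.
under eq_fun do rewrite expiE/=.
apply: (@brv_comp _ _ _ (@sin R)) => //; first exact: measurable_sinR.
by exists 1 => x; exact: norm_sin_le1.
Qed.

End ComplexExpectation.

Section OneStepProcess.
Context {R : realType} {d : measure_display} {T : measurableType d}.
Variable P : probability T R.
Variables (k lambda beta1 beta2 p : R).
Hypotheses (hk : 0 < k) (hlambda : 0 < lambda)
  (hbeta1 : 0 < beta1) (hbeta2 : 0 < beta2) (hp : 0 <= p <= 1).
Variables (N : R -> {RV P >-> nat}) (J : nat -> {RV P >-> R})
  (Z : R -> {RV P >-> R}).
Hypothesis hN : poisson_process lambda N.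
Hypothesis hJ : mutually_independent P (fun n => g_sigma_algebra_preimage (J n)).
Hypothesis hNJ : independent2 P
  (sigma_family [set t : R | 0 <= t] (fun t => N t : T -> nat))
  (sigma_family [set: nat] (fun n => J n : T -> R)).
Hypothesis hZ : forall t w, 0 <= t -> Z t w = \sum_(n < N t w) J n w.
Hypothesis chfJ : forall n theta,
  Ex P (fun w => cos (theta * J n w))
    = complex.Re (phi_dexp beta1 beta2 p theta) /\
  Ex P (fun w => sin (theta * J n w))
    = complex.Im (phi_dexp beta1 beta2 p theta).
Variables (M : nat) (t : nat -> R).
Hypotheses (t0 : t 0%N = 0) (tS : forall i, t i <= t i.+1).

Let t_ge0 i : 0 <= t i.
Proof. by elim: i => [|i ih]; rewrite ?t0// (le_trans ih). Qed.

Local Notation known_at := (known N J M t).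
Local Notation jumps := (jumped N t).

Definition knownC m (F : T -> R[i]) :=
  known_at m (fun w => complex.Re (F w)) /\ known_at m (fun w => complex.Im (F w)).

Lemma knownCM m F G : knownC m F -> knownC m G -> knownC m (fun w => F w * G w).
Proof.
move=> [F1 F2] [G1 G2]; split.
  under eq_fun do rewrite cReM.
  apply: knownD; first exact: knownM.
  under eq_fun do rewrite -mulN1r.
  by apply: knownM; [exact: known_cst|exact: knownM].
by under eq_fun do rewrite cImM; apply: knownD; exact: knownM.
Qed.

Lemma knownC_expi m X : known_at m X -> knownC m (fun w => expi (X w)).
Proof.
move=> kX; split.
  by under eq_fun do rewrite expiE/=; apply: known_comp => //; exact: measurable_cosR.
by under eq_fun do rewrite expiE/=; apply: known_comp => //; exact: measurable_sinR.
Qed.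

(** [gc] and [gs] express the cosine and sine of [X] through the next jump: the constants 1 and 0 in
    the case [l = 0], the cosine and sine of [theta * x] in the case [l = 1]. *)
Lemma Ec_known_increment (m : 'I_M) l (gc gs : R -> R) (c : R[i]) (H : T -> R[i])
    (X : T -> R) :
  t m < t m.+1 -> brvC H -> knownC m H -> measurable_fun setT X ->
  measurable_fun setT gc -> (forall x, `|gc x| <= 1) ->
  measurable_fun setT gs -> (forall x, `|gs x| <= 1) ->
  (forall q, Ex P (gc \o J q) = complex.Re c) ->
  (forall q, Ex P (gs \o J q) = complex.Im c) ->
  (forall w, good N t w -> jumps m l w ->
    cos (X w) = gc (J (N (t m) w) w) /\ sin (X w) = gs (J (N (t m) w) w)) ->
  Ec P (fun w => H w * ((jumps m l w)%:R%:C * expi (X w)))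
    = (poisson_pmf (lambda * (t m.+1 - t m)) l)%:C * c * Ec P H.
Proof.
move=> tm [bH1 bH2] [kH1 kH2] mX mgc bgc mgs bgs Egc Egs XJ.
have bc : brv (fun w => cos (X w)).
  apply: (@brv_comp _ _ _ (@cos R)) => //; first exact: measurable_cosR.
  by exists 1 => x; exact: norm_cos_le1.
have bs : brv (fun w => sin (X w)).
  apply: (@brv_comp _ _ _ (@sin R)) => //; first exact: measurable_sinR.
  by exists 1 => x; exact: norm_sin_le1.
have main := Ex_known_increment hN hJ hNJ t0 tS tm.
have Ic H' bH' kH' := main l gc (complex.Re c) H' _ bH' kH' bc mgc
  (ex_intro _ 1 bgc) Egc (fun w gw jw => proj1 (XJ w gw jw)).
have Is H' bH' kH' := main l gs (complex.Im c) H' _ bH' kH' bs mgs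
  (ex_intro _ 1 bgs) Egs (fun w gw jw => proj2 (XJ w gw jw)).
have bj : brv (fun w => (jumps m l w)%:R : R).
  by apply: brv_bool; exact: measurable_jumped.
have bb (F : T -> R) (G : T -> R) : brv F -> brv G ->
    brv (fun w => F w * ((jumps m l w)%:R * G w)).
  by move=> bF bG; apply: brvM => //; exact: brvM.
set pl := poisson_pmf _ _; rewrite /Ec; apply: complexP; rewrite !cplxE/=.
  transitivity (Ex P (fun w => complex.Re (H w) * ((jumps m l w)%:R * cos (X w))
      - complex.Im (H w) * ((jumps m l w)%:R * sin (X w)))).
    by congr Ex; apply/funext => w; rewrite expiE !cplxE/=; ring.
  rewrite ExB; [|exact: bb|exact: bb].
  by rewrite Ic// Is// -/pl; ring.
transitivity (Ex P (fun w => complex.Re (H w) * ((jumps m l w)%:R * sin (X w))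
    + complex.Im (H w) * ((jumps m l w)%:R * cos (X w)))).
  by congr Ex; apply/funext => w; rewrite expiE !cplxE/=; ring.
rewrite ExD; [|exact: bb|exact: bb].
by rewrite Ic// Is// -/pl; ring.
Qed.

Lemma one_step_process (m : 'I_M) (H : T -> R[i]) (theta K h : R) :
  h = t m.+1 - t m -> 0 < h ->
  brvC H -> knownC m H -> (forall w, normc (H w) <= K) ->
  normc (Ec P (fun w => H w * expi (theta * (Z (t m.+1) w - Z (t m) w)))
    - ((expR (- (lambda * h)))%:C
       + (lambda * h * expR (- (lambda * h)))%:C * phi_dexp beta1 beta2 p theta)
      * Ec P H) <= 2 * (K * (lambda * h) ^+ 2).
Proof.
move=> hE h0 bH kH HK; have tm : t m < t m.+1 by rewrite -subr_gt0 -hE.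
pose X w := theta * (Z (t m.+1) w - Z (t m) w).
have mX : measurable_fun setT X.
  by apply: measurable_funM => //; exact: measurable_funB.
set y := lambda * h.
have y0 : 0 < y by rewrite mulr_gt0.
have p0 : poisson_pmf y 0%N = expR (- y).
  by rewrite /poisson_pmf y0 expr0 fact0 divr1 mul1r.
have p1 : poisson_pmf y 1%N = y * expR (- y).
  by rewrite /poisson_pmf y0 expr1 factS fact0 divr1.
have ZE w : good N t w -> forall l, jumps m l w ->
    Z (t m.+1) w - Z (t m) w = \sum_(n < l) J (N (t m) w + n)%N w.
  move=> gw l /eqP Nl; rewrite !hZ// Nl big_split_ord/=.
  by rewrite addrAC subrr add0r.
have E0 : Ec P (fun w => H w * ((jumps m 0 w)%:R%:C * expi (X w))) =
    (expR (- y))%:C * Ec P H.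
  rewrite (@Ec_known_increment m 0 (fun=> 1) (fun=> 0) 1)//.
  - by rewrite -hE -/y p0 mulr1.
  - by move=> x; rewrite normr1.
  - by move=> x; rewrite normr0 ler01.
  - by move=> q; exact: Ex_cst.
  - by move=> q; exact: Ex_cst.
  - by move=> w gw jw; rewrite /X (ZE w gw _ jw) big_ord0 mulr0 cos0 sin0.
have E1 : Ec P (fun w => H w * ((jumps m 1 w)%:R%:C * expi (X w))) =
    (y * expR (- y))%:C * phi_dexp beta1 beta2 p theta * Ec P H.
  rewrite (@Ec_known_increment m 1 (fun x => cos (theta * x))
    (fun x => sin (theta * x)) (phi_dexp beta1 beta2 p theta))//.
  - by rewrite -hE -/y -p1.
  - by apply: measurableT_comp; [exact: measurable_cosR|exact: measurable_funM].
  - by move=> x; exact: norm_cos_le1.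
  - by apply: measurableT_comp; [exact: measurable_sinR|exact: measurable_funM].
  - by move=> x; exact: norm_sin_le1.
  - by move=> q; case: (chfJ q theta).
  - by move=> q; case: (chfJ q theta).
  - by move=> w gw jw; rewrite /X (ZE w gw _ jw) big_ord_recl big_ord0 addr0 addn0.
(* Up to a null set, the indicator of at least two jumps in the step; its mean is 1 - (1 + y)
   exp(-y). *)
pose j2 w : R := 1 - (jumps m 0 w)%:R - (jumps m 1 w)%:R.
have bj l : brv (fun w => (jumps m l w)%:R : R).
  by apply: brv_bool; exact: measurable_jumped.
have bj2 : brv j2 by apply: brvB => //; apply: brvB => //; exact: brv_cst.
have bX := brvC_expi mX.
have j2_ge0 w : 0 <= j2 w.
  have : ~~ (jumps m 0 w && jumps m 1 w).
    by rewrite /jumped; apply/negP => /andP[/eqP ->]; rewrite eqn_add2l.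
  by rewrite /j2; case: (jumps m 0 w); case: (jumps m 1 w) => //= _; lra.
have -> : Ec P (fun w => H w * expi (X w)) =
    Ec P (fun w => H w * ((jumps m 0 w)%:R%:C * expi (X w)))
    + Ec P (fun w => H w * ((jumps m 1 w)%:R%:C * expi (X w)))
    + Ec P (fun w => H w * ((j2 w)%:C * expi (X w))).
  have bHl f : brv f -> brvC (fun w => H w * ((f w)%:C * expi (X w))).
    by move=> bf; apply: brvCM => //; apply: brvCM => //; exact: brvC_real.
  rewrite -EcD; [|exact: bHl|exact: bHl].
  rewrite -EcD; [|by apply: brvCD; exact: bHl|exact: bHl].
  by apply: eq_Ec => w; rewrite /j2 !rmorphB rmorph1; move: (expi (X w)) => e; ring.
rewrite E0 E1 mulrDl addrAC subrr add0r.
set F := fun w => _.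
have bF : brvC F by apply: brvCM => //; apply: brvCM => //; exact: brvC_real.
rewrite (le_trans (normc_Ec_le P bF (brvM (brv_cst K) bj2) _))//.
  move=> w; rewrite /F normcM [normc (_ * expi _)]normcM normc_real normc_expi.
  rewrite mulr1 ger0_norm//.
  by rewrite ler_wpM2r.
rewrite ler_wpM2l// ExZ// ler_wpM2l//.
  have : 0 <= normc (H point) by exact: normc_ge0.
  by move/le_trans; apply.
rewrite ExB ?Ex_cst//; last first.
  by apply: brvB => //; exact: brv_cst.
rewrite ExB//; last exact: brv_cst.
rewrite Ex_cst !(Ex_jumped J hN t0 tS)// -hE -/y p0 p1.
(* By exp(-y) >= 1 - y, the mean of [j2] is at most 1 - (1 + y)(1 - y) = y^2. *)
have := expR_ge1Dx (- y); nra.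
Qed.

Local Notation logpsi := (logpsi k lambda beta1 beta2 p).

(** The latest increment is split off and the earlier ones are absorbed into the history [Hj].
    Increment [i] carries its weight in the scheme, so consecutive frequencies differ by the factor
    [q] and the exponents telescope. [H] is required at every later grid time because [known m]
    refers to the count at [t m]. *)
Lemma Ec_euler (m0 n : nat) (h v V C K : R) (H : T -> R[i]) :
  (m0 + n <= M)%N -> 0 < h -> k * h <= 1 -> `|v| <= V ->
  (forall j, (j < n)%N -> h = t (m0 + j).+1 - t (m0 + j)%N) ->
  0 <= C -> (forall h theta, 0 <= h -> k * h <= 1 -> `|theta| <= V ->
    normc ((expR (- (lambda * h)))%:C
         + (lambda * h * expR (- (lambda * h)))%:C * phi_dexp beta1 beta2 p theta
         - cexp (logpsi ((1 - k * h) * theta) - logpsi theta)) <= C * h ^+ 2) ->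
  brvC H -> (forall m, (m0 <= m)%N -> (m <= M)%N -> knownC m H) ->
  (forall w, normc (H w) <= K) -> 0 <= K ->
  let q := 1 - k * h in
  forall j, (j <= n)%N ->
  normc (Ec P (fun w => H w * expi (\sum_(i < j) v * q ^+ (n - i.+1)
           * (Z (t (m0 + i).+1) w - Z (t (m0 + i)%N) w)))
    - Ec P H * cexp (logpsi (v * q ^+ n) - logpsi (v * q ^+ (n - j))))
  <= j%:R * (2 * K * (lambda ^+ 2 + C) * h ^+ 2).
Proof.
move=> nM h0 kh vV th C0 hC bH kH HK K0 q; elim=> [_|j ih jn].
  rewrite subn0 subrr cexp0 mulr1 mul0r.
  set A := Ec P _; have -> : A = Ec P H.
    apply: eq_Ec => w; rewrite big_ord0 expiE cos0 sin0.
    by rewrite (_ : 1 +i* 0 = 1)// mulr1.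
  by rewrite subrr /= expr0n/= addr0 sqrtr0.
have {}ih := ih (ltnW jn).
pose theta := v * q ^+ (n - j.+1).
pose S w := \sum_(i < j) v * q ^+ (n - i.+1)
           * (Z (t (m0 + i).+1) w - Z (t (m0 + i)%N) w).
have q0 : 0 <= q by rewrite subr_ge0.
have q1 : q <= 1 by rewrite lerBlDr lerDl mulr_ge0// ltW.
have thetaV : `|theta| <= V.
  rewrite normrM (le_trans _ vV)// ler_piMr// ger0_norm ?exprn_ge0//.
  exact: exprn_ile1.
have qtheta : q * theta = v * q ^+ (n - j).
  by rewrite /theta mulrCA -exprS subnSK.
have mjM : (m0 + j < M)%N by rewrite (leq_trans _ nM)// ltn_add2l.
have mS : measurable_fun setT S.
  apply: measurable_sum => i; apply: measurable_funM => //.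
  exact: measurable_funB.
pose Hj w := H w * expi (S w).
have bHj : brvC Hj by apply: brvCM => //; exact: brvC_expi.
have HjK w : normc (Hj w) <= K by rewrite normcM normc_expi mulr1.
have kHj : knownC (m0 + j) Hj.
  apply: knownCM; first by apply: kH; [exact: leq_addr|exact: ltnW].
  apply: knownC_expi; apply: known_sum => i _; apply: knownM; first exact: known_cst.
  apply: knownD.
    by apply: (known_Z hZ t0 tS); [rewrite -addnS leq_add2l|exact: ltnW].
  under eq_fun do rewrite -mulN1r; apply: knownM; first exact: known_cst.
  by apply: (known_Z hZ t0 tS); [rewrite leq_add2l ltnW|exact: ltnW].
have := @one_step_process (Ordinal mjM) Hj theta K h (th j jn) h0 bHj kHj HjK.
set A' := Ec P _; set a := ((expR _)%:C + _) => st.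
have -> : Ec P (fun w => H w * expi (\sum_(i < j.+1) v * q ^+ (n - i.+1)
           * (Z (t (m0 + i).+1) w - Z (t (m0 + i)%N) w))) = A'.
  by apply: eq_Ec => w; rewrite big_ord_recr/= expiD mulrA.
pose b := cexp (logpsi (q * theta) - logpsi theta).
have hab : normc (a - b) <= C * h ^+ 2 by apply: hC => //; exact: ltW.
have nb : normc b <= 1.
  rewrite /b normc_cexp -expR0 ler_expR; apply: Re_logpsi_le => //.
  by rewrite exprMn ler_piMl ?sqr_ge0// exprn_ile1.
have nHj : normc (Ec P Hj) <= 2 * K.
  by rewrite -[K in leRHS](Ex_cst P); apply: normc_Ec_le => //; exact: brv_cst.
have -> : cexp (logpsi (v * q ^+ n) - logpsi (v * q ^+ (n - j.+1))) =
    b * cexp (logpsi (v * q ^+ n) - logpsi (v * q ^+ (n - j))).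
  rewrite /b -cexpD qtheta; congr cexp; rewrite -/theta.
  by rewrite [RHS]addrC addrA subrK.
set B := cexp _ in ih *.
(* Error of the current step, replacement of [a] by the factor [b], and the inherited error, which
   is not enlarged since [b] has modulus at most 1. *)
have -> : A' - Ec P H * (b * B) =
    (A' - a * Ec P Hj) + (a - b) * Ec P Hj + b * (Ec P Hj - Ec P H * B) by ring.
rewrite (le_trans (le_normcD _ _))// -[j.+1%:R]natr1 [leRHS]mulrDl mul1r.
rewrite [leRHS]addrC lerD//; last first.
  rewrite normcM (le_trans _ ih)// ler_piMl//; exact: normc_ge0.
rewrite (le_trans (le_normcD _ _))// (le_trans (lerD st (lexx _)))//.
rewrite normcM (le_trans (lerD (lexx _) (ler_pM _ _ hab nHj)))//.
- exact: normc_ge0.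
- exact: normc_ge0.
by rewrite le_eqVlt; apply/orP; left; apply/eqP; ring.
Qed.

End OneStepProcess.

(** * Passage to the limit *)

Section ComplexLimits.
Context {R : realType}.

Lemma cvg_dist_le (u e : nat -> R) (l : R) :
  (\forall n \near \oo, `|u n - l| <= e n) -> e n @[n --> \oo] --> (0 : R) ->
  u n @[n --> \oo] --> l.
Proof.
move=> ue e0; apply/cvgrPdist_lt => eps eps0; near=> n.
rewrite distrC; apply: (@le_lt_trans _ _ (e n)); first by near: n.
by near: n; exact: (cvgr_lt _ e0 eps eps0).
Unshelve. all: by end_near. Qed.

(** Complex convergence is expressed by the moduli of differences, so that only limits in [R]
    occur. *)
Lemma cvg_normcB (u : nat -> R[i]) (z : R[i]) :
  complex.Re (u n) @[n --> \oo] --> complex.Re z ->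
  complex.Im (u n) @[n --> \oo] --> complex.Im z ->
  normc (u n - z) @[n --> \oo] --> (0 : R).
Proof.
move=> uR uI.
have h : `|complex.Re (u n) - complex.Re z| + `|complex.Im (u n) - complex.Im z|
    @[n --> \oo] --> (0 : R).
  rewrite -[X in _ --> X]addr0; apply: cvgD; rewrite -[X in _ --> X](@normr0 _ R).
    by apply: cvg_norm; apply/subr_cvg0.
  by apply: cvg_norm; apply/subr_cvg0.
apply: (squeeze_cvgr _ (cvg_cst 0) h).
apply: nearW => n; rewrite normc_ge0/= (le_trans (normc_le _))//.
by rewrite !cplxE.
Qed.

Lemma cvg_divn (c : R) : c / n%:R @[n --> \oo] --> (0 : R).
Proof.
rewrite -[X in _ --> X](mulr0 c); apply: cvgM; first exact: cvg_cst.
apply/gtr0_cvgV0; first by near=> n; rewrite ltr0n; near: n; exact: nbhs_infty_gt.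
exact: cvgr_idn.
Unshelve. all: by end_near. Qed.

Lemma norm_exprB (a b : R) n : 0 <= a <= 1 -> 0 <= b <= 1 ->
  `|a ^+ n - b ^+ n| <= n%:R * `|a - b|.
Proof.
move=> /andP[a0 a1] /andP[b0 b1]; elim: n => [|n ih].
  by rewrite !expr0 subrr normr0 mul0r.
have -> : a ^+ n.+1 - b ^+ n.+1 = a * (a ^+ n - b ^+ n) + (a - b) * b ^+ n.
  by rewrite !exprS; ring.
rewrite (le_trans (ler_normD _ _))// -[n.+1%:R]natr1 [leRHS]mulrDl mul1r lerD// normrM.
  by rewrite (ger0_norm a0) (le_trans _ ih)// ler_piMl.
by rewrite ler_piMr// ger0_norm ?exprn_ge0// exprn_ile1.
Qed.

(** Replacing 1 - y/n by exp(-y/n), both in [0, 1], costs at most (y/n)^2 per factor, hence y^2/n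
    for the power. *)
Lemma cvg_expr_expR (y : R) : 0 <= y ->
  (1 - y / n%:R) ^+ n @[n --> \oo] --> expR (- y).
Proof.
move=> y0; apply: (cvg_dist_le _ (cvg_divn (y ^+ 2))); near=> n.
have n0 : (0 < n)%N by near: n; exact: nbhs_infty_gt.
have n0' : n%:R != 0 :> R by rewrite pnatr_eq0 -lt0n.
have yn : y / n%:R <= 1.
  rewrite ler_pdivrMr ?ltr0n// mul1r; near: n.
  exact: nbhs_infty_ger.
have yn0 : 0 <= y / n%:R by rewrite divr_ge0.
have -> : expR (- y) = expR (- (y / n%:R)) ^+ n.
  by rewrite -expRM_natl; congr expR; field.
rewrite (le_trans (norm_exprB _ _ _))//.
- by rewrite subr_ge0 yn/= lerBlDr lerDl.
- by rewrite expR_ge0/= -[leRHS]expR0 ler_expR oppr_le0.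
rewrite distrC (@le_trans _ _ (n%:R * (y / n%:R) ^+ 2))//.
  by rewrite ler_wpM2l// expRN_taylor.
by rewrite le_eqVlt; apply/orP; left; apply/eqP; field.
Unshelve. all: by end_near. Qed.

Lemma cvg_cexp (u : nat -> R[i]) (z : R[i]) :
  normc (u n - z) @[n --> \oo] --> (0 : R) ->
  normc (cexp (u n) - cexp z) @[n --> \oo] --> (0 : R).
Proof.
move=> uz.
have cR : complex.Re (u n) @[n --> \oo] --> complex.Re z.
  by apply: (cvg_dist_le _ uz); apply: nearW => n; rewrite -cReN -cReD normc_geRe.
have cI : complex.Im (u n) @[n --> \oo] --> complex.Im z.
  by apply: (cvg_dist_le _ uz); apply: nearW => n; rewrite -cImN -cImD normc_geIm.
have ce : expR (complex.Re (u n)) @[n --> \oo] --> expR (complex.Re z).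
  by apply: continuous_cvg => //; exact: continuous_expR.
apply: cvg_normcB.
  have E w : complex.Re (cexp w : R[i]) = expR (complex.Re w) * cos (complex.Im w).
    by rewrite /cexp !cplxE/=; ring.
  under eq_fun do rewrite E; rewrite E; apply: cvgM => //.
  by apply: continuous_cvg => //; exact: continuous_cos.
have E w : complex.Im (cexp w : R[i]) = expR (complex.Re w) * sin (complex.Im w).
  by rewrite /cexp !cplxE/=; ring.
under eq_fun do rewrite E; rewrite E; apply: cvgM => //.
by apply: continuous_cvg => //; exact: continuous_sin.
Qed.

Section Expectation.
Context {d : measure_display} {T : measurableType d}.
Variable P : probability T R.

Lemma cvg_Ec_expi (f : R -> R) (B : R) (U V : nat -> T -> R) (u v : T -> R) :
  continuous f -> (forall x, `|f x| <= B) ->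
  (forall n, measurable_fun setT (U n)) -> (forall n, measurable_fun setT (V n)) ->
  measurable_fun setT u -> measurable_fun setT v ->
  {ae P, forall w, U n w @[n --> \oo] --> u w} ->
  {ae P, forall w, V n w @[n --> \oo] --> v w} ->
  normc (Ec P (fun w => (f (U n w))%:C * expi (V n w))
    - Ec P (fun w => (f (u w))%:C * expi (v w))) @[n --> \oo] --> (0 : R).
Proof.
move=> cf fB mU mV mu mv Uu Vv.
have mf : measurable_fun setT f by exact: continuous_measurable_fun.
have EcE (a b : T -> R) : Ec P (fun w => (f (a w))%:C * expi (b w)) =
    Ex P (fun w => f (a w) * cos (b w)) +i* Ex P (fun w => f (a w) * sin (b w)).
  rewrite /Ec; congr (_ +i* _); congr Ex; apply/funext => w; rewrite expiE !cplxE/=;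
    ring.
have main (g : R -> R) : continuous g -> (forall x, `|g x| <= 1) ->
    Ex P (fun w => f (U n w) * g (V n w)) @[n --> \oo]
      --> Ex P (fun w => f (u w) * g (v w)).
  move=> cg g1; have mg : measurable_fun setT g by exact: continuous_measurable_fun.
  apply: (@Ex_cvg _ _ _ _ _ _ B) => //.
  - by move=> n; apply: measurable_funM; apply: measurableT_comp.
  - by apply: measurable_funM; apply: measurableT_comp.
  - move=> n w; rewrite normrM -[leRHS]mulr1 ler_pM//.
  - near=> w; apply: cvgM.
      by apply: continuous_cvg; [exact: cf|near: w].
    by apply: continuous_cvg; [exact: cg|near: w].
under eq_fun do rewrite !EcE.
apply: cvg_normcB => /=; apply: main.
- exact: continuous_cos.
- exact: norm_cos_le1.
- exact: continuous_sin.
- exact: norm_sin_le1.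
Unshelve. all: by end_near. Qed.

End Expectation.
End ComplexLimits.

Section TwoPhaseGrid.
Context {R : realType}.
Variables (s t : R) (n : nat).
Hypotheses (hs : 0 <= s) (ht : 0 <= t) (n0 : (0 < n)%N).

(** A single grid with [s] at index [n], so that the approximation of [X s] and the later increments
    of [Z] involve one independent family. For [s = 0] the first phase has steps of length zero,
    whence only weak monotonicity. *)
Definition two_phase_grid i : R :=
  if (i <= n)%N then i%:R * (s / n%:R) else s + (i - n)%:R * (t / n%:R).

Let nn0 : n%:R != 0 :> R.
Proof. by rewrite pnatr_eq0 -lt0n. Qed.

Lemma two_phase_grid0 : two_phase_grid 0 = 0.
Proof. by rewrite /two_phase_grid mul0r. Qed.

Lemma two_phase_grid_first i : (i <= n)%N -> two_phase_grid i = i%:R * (s / n%:R).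
Proof. by rewrite /two_phase_grid => ->. Qed.

Lemma two_phase_grid_second j : two_phase_grid (n + j) = s + j%:R * (t / n%:R).
Proof.
rewrite /two_phase_grid; case: j => [|j].
  by rewrite addn0 leqnn mul0r addr0 mulrCA divff// mulr1.
by rewrite addnS ltnNge leq_addr/= -addnS addKn.
Qed.

Lemma two_phase_grid_le i : two_phase_grid i <= two_phase_grid i.+1.
Proof.
have [ni|ni] := ltnP i n.
  rewrite !two_phase_grid_first//; last exact: ltnW.
  by rewrite ler_wpM2r ?divr_ge0// ler_nat.
rewrite -(subnKC ni) -addnS !two_phase_grid_second lerD2l.
by rewrite ler_wpM2r ?divr_ge0// ler_nat.
Qed.

End TwoPhaseGrid.

Section Transition.
Context {R : realType} {d : measure_display} {T : measurableType d}.
Variable P : probability T R.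
Variables (k lambda beta1 beta2 p x0 : R).
Hypotheses (hk : 0 < k) (hlambda : 0 < lambda)
  (hbeta1 : 0 < beta1) (hbeta2 : 0 < beta2) (hp : 0 <= p <= 1).
Variables (Z X : R -> {RV P >-> R}).
Hypothesis hZ : compound_poisson_process P lambda
  (double_exponential_pdf beta1 beta2 p) Z.
Hypothesis hX : sde_solution P k x0 Z X.
Local Notation logpsi := (logpsi k lambda beta1 beta2 p).

Lemma euler_scheme_ae (a len : R) : 0 <= a -> 0 <= len -> {ae P, forall w,
  exists C : R, forall n, (0 < n)%N -> k * (len / n%:R) <= 1 ->
  `|X (a + len) w - ((1 - k * (len / n%:R)) ^+ n * X a w
     + \sum_(i < n) (1 - k * (len / n%:R)) ^+ (n - i.+1)
        * (Z (a + i.+1%:R * (len / n%:R)) w - Z (a + i%:R * (len / n%:R)) w))|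
  <= C / n%:R}.
Proof.
move=> a0 l0; have [N [J [[aeN _ _] _ _ _ ZE]]] := hZ.
apply: filterS2 aeN hX => w [_ Nle _] [_ xE].
(* The sum of the absolute values of the jumps so far dominates the variation of [Z] along the
   path. *)
apply: (@euler_scheme _ k (X ^~ w) (Z ^~ w)
  (fun u => \sum_(j < N u w) `|J j w|)) => //.
- by move=> u u0; case: (xE u u0).
- by move=> u u0; case: (xE u u0).
move=> r u r0 ru; rewrite !ZE//; last exact: le_trans ru.
have := Nle r u r0 ru; set A := N r w; set B := N u w => AB.
rewrite -(big_mkord xpredT (fun j => J j w)) -(big_mkord xpredT (fun j => J j w)).
rewrite -(big_mkord xpredT (fun j => `|J j w|)) -(big_mkord xpredT (fun j => `|J j w|)).
rewrite !(big_cat_nat (m := 0%N) (n := A) (p := B))//= addrAC subrr add0r.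
by rewrite addrAC subrr add0r ler_norm_sum.
Qed.

Lemma transition_continuous (f : R -> R) (B s t v : R) :
  continuous f -> (forall x, `|f x| <= B) -> 0 <= s -> 0 < t ->
  Ec P (fun w => (f (X s w))%:C * expi (v * X (t + s) w)) =
  Ec P (fun w => (f (X s w))%:C * expi (v * expR (- (k * t)) * X s w))
  * cexp (logpsi (v * expR (- (k * t))) - logpsi v).
Proof.
move=> cf fB hs ht.
have [N [J [hN hJ dJ hNJ ZE]]] := hZ.
have chfJ n theta := Ex_double_exponential theta hbeta1 hbeta2 hp (dJ n).
have mf : measurable_fun setT f by exact: continuous_measurable_fun.
have B0 : 0 <= B by apply: le_trans (fB 0).
have [C C0 hC] := step_estimate hk hlambda hbeta1 hbeta2 hp `|v|.
pose q0 n : R := 1 - k * (s / n%:R).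
pose q n : R := 1 - k * (t / n%:R).
pose tau n := two_phase_grid s t n.
pose Xs n w := q0 n ^+ n * x0 + \sum_(i < n) q0 n ^+ (n - i.+1)
  * (Z (tau n i.+1) w - Z (tau n i) w).
pose dX n w := \sum_(i < n) q n ^+ (n - i.+1)
  * (Z (tau n (n + i).+1) w - Z (tau n (n + i)%N) w).
(* The second phase starts from the approximation [Xs] and not from [X s], so that everything is a
   function of increments of [Z] on the grid. *)
pose Xt n w := q n ^+ n * Xs n w + dX n w.
have small c : \forall n \near \oo, c / n%:R <= 1 :> R.
  near=> n; rewrite ler_pdivrMr ?ltr0n//; last by near: n; exact: nbhs_infty_gt.
  by rewrite mul1r; near: n; exact: nbhs_infty_ger.
have qn : q n ^+ n @[n --> \oo] --> expR (- (k * t)).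
  have := @cvg_expr_expR R (k * t); rewrite mulr_ge0 ?ltW// => /(_ isT).
  by under eq_fun do rewrite -mulrA.
have Xs_cvg : {ae P, forall w, Xs n w @[n --> \oo] --> X s w}.
  have X0 : {ae P, forall w, X 0 w = x0} by apply: filterS hX => w [].
  apply: filterS2 X0 (euler_scheme_ae (lexx 0) hs) => w X0 [C1 hC1].
  apply: (cvg_dist_le _ (cvg_divn C1)); near=> n; rewrite distrC.
  have n0 : (0 < n)%N by near: n; exact: nbhs_infty_gt.
  have := hC1 n n0; rewrite (add0r s) X0.
  have <- : Xs n w = q0 n ^+ n * x0 + \sum_(i < n) q0 n ^+ (n - i.+1)
      * (Z (0 + i.+1%:R * (s / n%:R)) w - Z (0 + i%:R * (s / n%:R)) w).
    congr (_ + _); apply: eq_bigr => i _; rewrite !add0r.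
    by rewrite -!(@two_phase_grid_first _ s t n)//; exact: ltnW.
  by apply; rewrite mulrA; near: n; exact: small.
have Xt_cvg : {ae P, forall w, Xt n w @[n --> \oo] --> X (t + s) w}.
  apply: filterS2 Xs_cvg (euler_scheme_ae hs (ltW ht)) => w Xsw [C1 hC1].
  have h1 : q n ^+ n * X s w + dX n w @[n --> \oo] --> X (t + s) w.
    apply: (cvg_dist_le _ (cvg_divn C1)); near=> n; rewrite distrC.
    have n0 : (0 < n)%N by near: n; exact: nbhs_infty_gt.
    have := hC1 n n0; rewrite (addrC s t).
    have <- : dX n w = \sum_(i < n) q n ^+ (n - i.+1)
        * (Z (s + i.+1%:R * (t / n%:R)) w - Z (s + i%:R * (t / n%:R)) w).
      apply: eq_bigr => i _.
      by rewrite -!(two_phase_grid_second s t n0) addnS.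
    by apply; rewrite mulrA; near: n; exact: small.
  have -> : (fun n => Xt n w) =
      (fun n => (q n ^+ n * X s w + dX n w) + q n ^+ n * (Xs n w - X s w)).
    by apply/funext => n; rewrite /Xt; ring.
  rewrite -[X in _ --> X]addr0; apply: cvgD => //.
  rewrite -[X in _ --> X](mulr0 (expR (- (k * t)))); apply: cvgM => //.
  exact/subr_cvg0.
have mXs n : measurable_fun setT (Xs n).
  apply: measurable_funD => //; apply: measurable_sum => i.
  by apply: measurable_funM => //; exact: measurable_funB.
have mXt n : measurable_fun setT (Xt n).
  apply: measurable_funD; first exact: measurable_funM.
  apply: measurable_sum => i.
  by apply: measurable_funM => //; exact: measurable_funB.
pose L n := Ec P (fun w => (f (Xs n w))%:C * expi (v * Xt n w)).
pose L' n := Ec P (fun w => (f (Xs n w))%:C * expi (v * q n ^+ n * Xs n w)).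
pose Psi n := cexp (logpsi (v * q n ^+ n) - logpsi v).
set l := Ec P _; set l' := Ec P _; set psi := cexp _.
have Ll : normc (L n - l) @[n --> \oo] --> (0 : R).
  apply: (cvg_Ec_expi (U := Xs) (V := fun n w => v * Xt n w) cf fB) => //.
  - by move=> n; exact: measurable_funM.
  - exact: measurable_funM.
  - by apply: filterS Xt_cvg => w h; apply: cvgM => //; exact: cvg_cst.
have vqn : v * q n ^+ n @[n --> \oo] --> v * expR (- (k * t)).
  by apply: cvgM => //; exact: cvg_cst.
have Ll' : normc (L' n - l') @[n --> \oo] --> (0 : R).
  apply: (cvg_Ec_expi (U := Xs) (V := fun n w => v * q n ^+ n * Xs n w) cf fB) => //.
  - by move=> n; exact: measurable_funM.
  - exact: measurable_funM.
  - by apply: filterS Xs_cvg => w h; exact: cvgM.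
have Psi_cvg : normc (Psi n - psi) @[n --> \oo] --> (0 : R).
  apply: cvg_cexp.
  set Kc := p * lambda / k * (2 * beta1^-1) + (1 - p) * lambda / k * (2 * beta2^-1).
  have h : Kc * `|v * q n ^+ n - v * expR (- (k * t))| @[n --> \oo] --> (0 : R).
    rewrite -[X in _ --> X](mulr0 Kc); apply: cvgM; first exact: cvg_cst.
    rewrite -[X in _ --> X](@normr0 _ R); apply: cvg_norm.
    exact/subr_cvg0.
  apply: (squeeze_cvgr _ (cvg_cst 0) h); apply: nearW => n.
  rewrite normc_ge0 opprB addrA subrK andTb.
  exact: logpsi_lipschitz.
(* The errors of [n] steps, 2 B (lambda^2 + C) (t/n)^2 each, add up to [D / n%:R]. *)
pose D : R := 2 * B * (lambda ^+ 2 + C) * t ^+ 2.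
have step : \forall n \near \oo, normc (L n - L' n * Psi n) <= D / n%:R.
  near=> n.
  have n0 : (0 < n)%N by near: n; exact: nbhs_infty_gt.
  have kh : k * (t / n%:R) <= 1 by rewrite mulrA; near: n; exact: small.
  have h0 : 0 < t / n%:R by rewrite divr_gt0// ltr0n.
  (* The part of the integrand determined at time [s]: [v * Xt n] is [v * q n ^+ n * Xs n] plus a
     combination of later increments. *)
  pose H w := (f (Xs n w))%:C * expi (v * q n ^+ n * Xs n w).
  have tS := two_phase_grid_le hs (ltW ht) n0.
  have t0 := two_phase_grid0 s t n.
  have bH : brvC H.
    apply: brvCM.
      by apply: brvC_real; apply: brv_comp => //; exists B.
    by apply: brvC_expi; exact: measurable_funM.
  have kXs m : (n <= m)%N -> (m <= n + n)%N -> known N J (n + n) (tau n) m (Xs n).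
    move=> nm mM; apply: knownD; first exact: known_cst.
    apply: known_sum => i _; apply: knownM; first exact: known_cst.
    apply: knownD.
      by apply: (known_Z ZE t0 tS) => //; exact: leq_trans nm.
    under eq_fun do rewrite -mulN1r; apply: knownM; first exact: known_cst.
    by apply: (known_Z ZE t0 tS) => //; apply: leq_trans nm; exact: ltnW.
  have kH m : (n <= m)%N -> (m <= n + n)%N -> knownC N J (n + n) (tau n) m H.
    move=> nm mM; apply: knownCM.
      split => /=; last exact: known_cst.
      by apply: known_comp => //; exact: kXs.
    by apply: knownC_expi; apply: knownM; [exact: known_cst|exact: kXs].
  have HB w : normc (H w) <= B by rewrite normcM normc_real normc_expi mulr1.
  have grid_step j : (j < n)%N -> t / n%:R = tau n (n + j).+1 - tau n (n + j)%N.
    move=> jn; rewrite /tau -addnS !two_phase_grid_second// -natr1; ring.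
  have := @Ec_euler _ _ _ P k lambda beta1 beta2 p hk hlambda hbeta1 hbeta2 hp N J Z
    hN hJ hNJ ZE chfJ (n + n) (tau n) t0 tS n n (t / n%:R) v `|v| C B H (leqnn _)
    h0 kh (lexx _) grid_step C0 hC bH kH HB B0 n (leqnn n).
  rewrite subnn expr0 mulr1 -/(q n).
  have -> : Ec P (fun w => H w * expi (\sum_(i < n) v * q n ^+ (n - i.+1)
      * (Z (tau n (n + i).+1) w - Z (tau n (n + i)%N) w))) = L n.
    apply: eq_Ec => w; rewrite /H -mulrA -expiD; congr (_ * expi _).
    transitivity (v * (q n ^+ n * Xs n w) + v * dX n w); last by rewrite -mulrDr.
    rewrite [v * (q n ^+ n * _)]mulrA; congr (_ + _).
    by rewrite mulr_sumr; apply: eq_bigr => i _; rewrite mulrA.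
  move/le_trans; apply; rewrite le_eqVlt; apply/orP; left; apply/eqP.
  by rewrite /D; field; rewrite pnatr_eq0 -lt0n.
have nPsi n : 0 <= q n -> q n <= 1 -> normc (Psi n) <= 1.
  move=> qn0 qn1; rewrite /Psi normc_cexp -expR0 ler_expR; apply: Re_logpsi_le => //.
  by rewrite exprMn ler_piMr ?sqr_ge0// exprn_ile1 ?exprn_ge0// exprn_ile1.
suff : normc (l - l' * psi) = 0 by move=> /eq0_normc/eqP; rewrite subr_eq0 => /eqP.
apply/eqP; rewrite eq_le normc_ge0 andbT.
(* The fixed modulus is bounded by four errors, from the limit [l], the scheme, the limit [l'] and
   the limit [psi]; all tend to zero. *)
pose e n := normc (L n - l) + D / n%:R + normc (L' n - l') + normc l' * normc (Psi n - psi).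
have e0 : e n @[n --> \oo] --> (0 : R).
  rewrite -[X in _ --> X](addr0 0) -[X in _ --> X + _](addr0 0).
  rewrite -[X in _ --> X + _ + _](addr0 0) -[X in _ --> _ + X](mulr0 (normc l')).
  apply: cvgD; [apply: cvgD => //; apply: cvgD => //; exact: cvg_divn|].
  by apply: cvgM => //; exact: cvg_cst.
apply: (cvgr_to_ge e0); near=> n.
have kh : k * (t / n%:R) <= 1 by rewrite mulrA; near: n; exact: small.
have qn0 : 0 <= q n by rewrite subr_ge0.
have qn1 : q n <= 1 by rewrite lerBlDr lerDl mulr_ge0 ?divr_ge0// ltW.
have -> : l - l' * psi = - (L n - l) + (L n - L' n * Psi n)
    + (L' n - l') * Psi n + l' * (Psi n - psi) by ring.
rewrite (le_trans (le_normcD _ _))// lerD//; last by rewrite normcM.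
rewrite (le_trans (le_normcD _ _))// lerD//; last first.
  by rewrite normcM ler_piMr ?normc_ge0// nPsi.
rewrite (le_trans (le_normcD _ _))// lerD ?normcN//.
by near: n.
Unshelve. all: by end_near. Qed.

End Transition.

(** * From continuous test functions to Borel events *)

Section FromContinuousToBorel.
Context {R : realType} {d : measure_display} {T : measurableType d}.
Variable P : probability T R.

(** The sum of [x - a] and its absolute value is twice the positive part, so these continuous
    functions vanish for [x <= a] and tend to 1 for [x > a]. *)
Let ramp (a : R) (n : nat) (x : R) : R :=
  1 - expR (- (n%:R * ((x - a) + `|x - a|))).

Let ramp_continuous a n : continuous (ramp a n).
Proof.
have h : continuous (fun x : R => n%:R * ((x - a) + `|x - a|)).
  move=> x; apply: cvgM; first exact: cvg_cst.
  have xa : y - a @[y --> x] --> x - a by apply: cvgB => //; exact: cvg_cst.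
  by apply: cvgD => //; exact: cvg_norm.
move=> x; apply: cvgB; first exact: cvg_cst.
by apply: continuous_cvg; [exact: continuous_expR|apply: cvgN; exact: h].
Qed.

Let posD (y : R) : 0 <= y + `|y|.
Proof. by rewrite -lerBlDl sub0r -normrN ler_norm. Qed.

Let ramp_bound a n x : `|ramp a n x| <= 1.
Proof.
rewrite ger0_norm /ramp; first by rewrite lerBlDr lerDl expR_ge0.
by rewrite subr_ge0 -[leRHS]expR0 ler_expR oppr_le0 mulr_ge0.
Qed.

Let ramp_cvg a x : ramp a n x @[n --> \oo] --> (((a < x)%R : bool)%:R : R).
Proof.
case: ltP => [ax|xa] /=.
  have M0 : 0 < (x - a) + `|x - a| by rewrite ltr_pwDl// subr_gt0.
  rewrite -[X in _ --> X]subr0; apply: cvgB; first exact: cvg_cst.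
  apply: (@cvg_comp _ _ _ (fun n => n%:R * ((x - a) + `|x - a|))
    (fun y => expR (- y)) _ (pinfty_nbhs R)); last exact: cvgr_expR.
  apply/cvgryPge => A; near=> n; rewrite -ler_pdivrMr//.
  by near: n; exact: nbhs_infty_ger.
apply: cvg_near_cst; apply: nearW => n.
by rewrite /ramp ler0_norm ?subr_le0// subrr mulr0 oppr0 expR0 subrr.
Unshelve. all: by end_near. Qed.

(** Open rays are a pi-system generating the Borel sets, and their indicators are bounded limits of
    ramps; the constant test function supplies [Ex U = 0], which covers the whole space. *)
Lemma Ex_borel_of_continuous (S U : T -> R) : measurable_fun setT S -> brv U ->
  (forall f : R -> R, continuous f -> (exists B : R, forall x, `|f x| <= B) ->
    Ex P (fun w => f (S w) * U w) = 0) ->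
  forall B, measurable B -> Ex P (fun w => \1_(S @^-1` B) w * U w) = 0.
Proof.
move=> mS bU fU.
have [mU [K hK]] := bU.
pose G : set (set T) := [set A | exists a : R, A = S @^-1` `]a, +oo[].
have Gm : G `<=` measurable.
  by move=> _ [a ->]; rewrite -[X in measurable X]setTI; exact: mS.
have sG B : measurable B -> <<s G >> (S @^-1` B).
  pose H : set (set R) := [set B | <<s G >> (S @^-1` B)].
  suff : (@measurable _ R : set (set R)) `<=` H by apply.
  rewrite [X in X `<=` _](RGenOInfty.measurableE R).
  apply: smallest_sub.
    split => [|A HA|F HF]; rewrite /H/=.
    - by rewrite preimage_set0; exact: (@measurable0 _ (g_sigma_algebraType G)).
    - rewrite setTD preimage_setC.
      exact: (@measurableC _ (g_sigma_algebraType G)).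
    - rewrite preimage_bigcup.
      exact: (@bigcupT_measurable _ (g_sigma_algebraType G)).
  by move=> _ [a ->]; apply: sub_sigma_algebra; exists a.
move=> B mB; apply: (pi_lambda_Ex bU _ _ Gm) (sG _ mB).
- have c1 : continuous (fun _ : R => 1 : R) by move=> x; exact: cvg_cst.
  have := fU _ c1.
  have -> : (fun w => 1 * U w) = U by apply/funext => w; rewrite mul1r.
  by apply; exists 1 => x; rewrite normr1.
- move=> _ _ [a ->] [b ->]; exists (Num.max a b); rewrite -preimage_setI.
  by apply/seteqP; split => w /=; rewrite !in_itv/= !andbT gt_max => /andP.
- move=> _ [a ->].
  have h : Ex P (fun w => ramp a n (S w) * U w) @[n --> \oo]
      --> Ex P (fun w => \1_(S @^-1` `]a, +oo[) w * U w).
    apply: (@Ex_cvg _ _ _ _ _ _ K) => //.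
    - move=> n; apply: measurable_funM => //; apply: measurableT_comp => //.
      by apply: continuous_measurable_fun; exact: ramp_continuous.
    - by apply: measurable_funM => //; apply: measurable_indic; apply: Gm; exists a.
    - move=> n w; rewrite normrM (le_trans _ (hK w))// ler_piMl//.
    - apply: aeW => w; apply: cvgM; last exact: cvg_cst.
      rewrite indicE (_ : (w \in _) = (a < S w)); first exact: ramp_cvg.
      by apply/idP/idP; [move/set_mem|move=> ?; apply/mem_set];
        rewrite /= in_itv/= andbT.
  have h0 : Ex P (fun w => ramp a n (S w) * U w) @[n --> \oo] --> (0 : R).
    apply: cvg_near_cst; apply: nearW => n; apply: fU.
      exact: ramp_continuous.
    by exists 1; exact: ramp_bound.
  exact: (cvg_unique _ h h0).
Qed.

Lemma EFin_Ex (f : T -> R) : brv f -> (\int[P]_w (f w)%:E = (Ex P f)%:E)%E.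
Proof.
by move=> bf; rewrite /Ex /Rintegral fineK//; exact/integrable_fin_num/brv_integrable.
Qed.

Lemma cond_expectation_of_continuous (S : {RV P >-> R}) (Y : T -> R) (g : R -> R) :
  brv Y -> measurable_fun setT g -> (exists B : R, forall x, `|g x| <= B) ->
  (forall f : R -> R, continuous f -> (exists B : R, forall x, `|f x| <= B) ->
    Ex P (fun w => f (S w) * Y w) = Ex P (fun w => f (S w) * g (S w))) ->
  is_cond_expectation P (g_sigma_algebra_preimage S) Y (g \o S).
Proof.
move=> bY mg bg hf.
have bgS : brv (g \o S) by exact: brv_comp.
split.
- exact: brv_integrable.
- move=> B mB; exists (g @^-1` B); last by rewrite setTI.
  by rewrite -[X in measurable X]setTI; exact: mg.
- exact: brv_integrable.
move=> _ [B mB <-]; rewrite setTI.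
have mA : measurable (S @^-1` B).
  by rewrite -[X in measurable X]setTI; exact: measurable_funPT.
have intE (f : T -> R) : brv f ->
    (\int[P]_(w in S @^-1` B) (f w)%:E = (Ex P (fun w => \1_(S @^-1` B) w * f w))%:E)%E.
  move=> bf; rewrite -EFin_Ex; last by apply: brvM => //; exact: brv_indic.
  rewrite integral_mkcond; apply: eq_integral => w _.
  by rewrite patchE indicE; case: ifP; rewrite ?mul1r ?mul0r.
rewrite intE// intE//; congr EFin; apply/eqP; rewrite -subr_eq0; apply/eqP.
have bfS (f : R -> R) : measurable_fun setT f ->
    (exists B : R, forall x, `|f x| <= B) -> brv (fun w => f (S w)).
  by move=> mf bf; apply: (brv_comp _ mf).
rewrite -ExB; [|by apply: brvM => //; exact: brv_indic
               |by apply: brvM => //; exact: brv_indic].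
have := @Ex_borel_of_continuous S (fun w => Y w - g (S w)) _ (brvB bY bgS) _ B mB.
move=> <- //.
  by congr Ex; apply/funext => w; rewrite mulrBr.
move=> f cf bf; have bfS' := bfS f (continuous_measurable_fun cf) bf.
transitivity (Ex P (fun w => f (S w) * Y w - f (S w) * g (S w))).
  by congr Ex; apply/funext => w; rewrite mulrBr.
rewrite ExB; [|exact: brvM|exact: brvM].
by rewrite hf// subrr.
Qed.

End FromContinuousToBorel.

(** * The conditional characteristic function *)

Lemma Ec_mulr (R : realType) (d : measure_display) (T : measurableType d)
    (P : probability T R) (F : T -> R[i]) (c : R[i]) :
  brvC F -> Ec P (fun w => F w * c) = Ec P F * c.
Proof.
move=> [bRe bIm]; rewrite /Ec; apply: complexP; rewrite !cplxE/= -!ExZr//.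
  rewrite -ExB; [|by apply: brvM => //; exact: brv_cst..].
  by congr Ex; apply/funext => w; rewrite cReM.
rewrite -ExD; [|by apply: brvM => //; exact: brv_cst..].
by congr Ex; apply/funext => w; rewrite cImM.
Qed.

Theorem theorem3p3 (R : realType) (d : measure_display)
    (T : measurableType d) (P : probability T R)
    (k lambda beta1 beta2 p x0 : R)
    (hk : 0 < k) (hlambda : 0 < lambda)
    (hbeta1 : 0 < beta1) (hbeta2 : 0 < beta2) (hp : 0 <= p <= 1)
    (Z X : R -> {RV P >-> R})
    (hZ : compound_poisson_process P lambda
            (double_exponential_pdf beta1 beta2 p) Z)
    (hX : sde_solution P k x0 Z X)
    (s t v : R) (hs : 0 <= s) (ht : 0 < t) :
  is_cond_expectationC P (g_sigma_algebra_preimage (X s))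
    (fun w => cexp (0 +i* (v * X (t + s) w)))
    (fun w =>
       cexp (0 +i* (v * X s w * expR (- k * t)))
       * (cpow (beta1 -i* (v * expR (- k * t))) (p * lambda / k)
          / cpow (beta1 -i* v) (p * lambda / k))
       * (cpow (beta2 +i* (v * expR (- k * t))) ((1 - p) * lambda / k)
          / cpow (beta2 +i* v) ((1 - p) * lambda / k))).
Proof.
set theta := v * expR (- k * t).
set Psi := cexp (logpsi k lambda beta1 beta2 p theta - logpsi k lambda beta1 beta2 p v).
(* The candidate as a function of the value of [X s]: a character times a constant, hence bounded by
   the modulus of [Psi] and measurable for the sigma-algebra of [X s]. *)
pose g x : R[i] := expi (theta * x) * Psi.
have gE : (fun w => cexp (0 +i* (v * X s w * expR (- k * t)))
       * (cpow (beta1 -i* (v * expR (- k * t))) (p * lambda / k)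
          / cpow (beta1 -i* v) (p * lambda / k))
       * (cpow (beta2 +i* (v * expR (- k * t))) ((1 - p) * lambda / k)
          / cpow (beta2 +i* v) ((1 - p) * lambda / k))) = fun w => g (X s w).
  apply/funext => w; rewrite -mulrA cpow_quotients// -/theta -/Psi.
  by rewrite /g /theta /expi [v * X s w * _]mulrAC.
rewrite gE.
have thetaE : theta = v * expR (- (k * t)) by rewrite /theta mulNr.
have mg : measurable_fun setT (fun x => complex.Re (g x)) /\
    measurable_fun setT (fun x => complex.Im (g x)).
  have mc : measurable_fun setT (fun x : R => cos (theta * x)).
    by apply: measurableT_comp; [exact: measurable_cosR|exact: measurable_funM].
  have ms : measurable_fun setT (fun x : R => sin (theta * x)).
    by apply: measurableT_comp; [exact: measurable_sinR|exact: measurable_funM].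
  split.
    under eq_fun do rewrite /g expiE cReM/=.
    by apply: measurable_funB; exact: measurable_funM.
  under eq_fun do rewrite /g expiE cImM/=.
  by apply: measurable_funD; exact: measurable_funM.
have gB x : normc (g x) <= normc Psi by rewrite /g normcM normc_expi mul1r.
have mvX : measurable_fun setT (fun w => v * X (t + s) w) by exact: measurable_funM.
have bY := brvC_expi mvX.
have main (f : R -> R) : continuous f -> (exists B : R, forall x, `|f x| <= B) ->
    Ec P (fun w => (f (X s w))%:C * expi (v * X (t + s) w)) =
    Ec P (fun w => (f (X s w))%:C * g (X s w)).
  move=> cf [B fB].
  rewrite (transition_continuous hk hlambda hbeta1 hbeta2 hp hZ hX v cf fB)//.
  rewrite -thetaE -/Psi -Ec_mulr; last first.
    apply: brvCM; last by apply: brvC_expi; exact: measurable_funM.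
    apply: brvC_real; apply: brv_comp => //; last by exists B.
    exact: continuous_measurable_fun.
  by apply: eq_Ec => w; rewrite /g mulrA.
have EcE (f : R -> R) (G : T -> R[i]) : Ec P (fun w => (f (X s w))%:C * G w) =
    Ex P (fun w => f (X s w) * complex.Re (G w))
    +i* Ex P (fun w => f (X s w) * complex.Im (G w)).
  by rewrite /Ec; congr (_ +i* _); congr Ex; apply/funext => w; rewrite !cplxE/=; ring.
split; [case: mg => mg _|case: mg => _ mg].
- apply: (@cond_expectation_of_continuous _ _ _ P (X s) _ (fun x => complex.Re (g x))).
  + by case: bY.
  + by [].
  + by exists (normc Psi) => x; exact: le_trans (normc_geRe _) (gB x).
  by move=> f cf bf; have := main f cf bf; rewrite !EcE => -[].
- apply: (@cond_expectation_of_continuous _ _ _ P (X s) _ (fun x => complex.Im (g x))).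
  + by case: bY.
  + by [].
  + by exists (normc Psi) => x; exact: le_trans (normc_geIm _) (gB x).
  by move=> f cf bf; have := main f cf bf; rewrite !EcE => -[].
Qed.
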